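(* Let $G$ be a Lie group in a Cartesian tangent category $(\mathbb X,\mathbb T)$, let $\mathfrak g$ be the object representing its Lie functor $\mathfrak g(-)$, and let $\omega:G\times\mathfrak g\to TG$ be the universal $\mathfrak g$-PLIVF. Let $0:*\to\mathfrak g$, $+:\mathfrak g\times\mathfrak g\to\mathfrak g$ and $[,]:\mathfrak g\times\mathfrak g\to\mathfrak g$ be the morphisms corresponding, under the representability of $\mathfrak g(-)$, to the $*$-PLIVF $z_G:G\to TG$, to the $(\mathfrak g\times\mathfrak g)$-PLIVF $\omega_1+\omega_2$ and to the $(\mathfrak g\times\mathfrak g)$-PLIVF $[\omega_1,\omega_2]$ respectively; that is, $0,+,[,]$ are the unique morphisms with $(\mathrm{id}_G\times 0)\omega=z_G$ (identifying $G\times *=G$), $(\mathrm{id}_G\times +)\omega=\omega_1+\omega_2$ and $(\mathrm{id}_G\times[,])\omega=[\omega_1,\omega_2]$, where $\omega_k=(\mathrm{id}_G\times\pi_k)\omega$ for $k=1,2$. Then $(\mathfrak g,0,+,[,])$ is a Lie algebra object in $\mathbb X$.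
   Context: Conventions. Composition is diagrammatic: $fg$ means first $f$, then $g$; $\langle f,g\rangle$ is pairing, $\pi_i$ are projections, $*$ is the terminal object and $!$ denotes maps to $*$. Tangent categories. A tangent structure $\mathbb T=(T,p,z,s,l,c)$ on a category $\mathbb X$ consists of an endofunctor $T$ and natural transformations $p_M:TM\to M$, $z_M:M\to TM$, $s_M:T_2M\to TM$, $l_M:TM\to TTM$, $c_M:TTM\to TTM$, where the $n$-fold pullback $T_nM$ of $p_M$ along itself exists and is preserved by all $T^k$, such that: $(p_M,z_M,s_M)$ is an additive bundle (a commutative monoid in $\mathbb X/M$); $(z_M,l_M):(p_M,z_M,s_M)\to(Tp_M,Tz_M,Ts_M)$ and $(\mathrm{id}_{TM},c_M):(p_{TM},z_{TM},s_{TM})\to(Tp_M,Tz_M,Ts_M)$ are additive bundle morphisms; $l_M\,Tl_M=l_M\,l_{TM}$, $c_Mc_M=\mathrm{id}$, $Tc_M\,c_{TM}\,Tc_M=c_{TM}\,Tc_M\,c_{TM}$, $l_Mc_M=l_M$, $l_{TM}\,Tc_M\,c_{TM}=c_M\,Tl_M$; and, with $\xi_M:=(z_{TM}\times l_M)\,Ts_M:T_2M\to TTM$, the square $\xi_M\,Tp_M=\pi_1p_Mz_M$ exhibits $T_2M$ as the pullback of $Tp_M$ along $z_M$. It is Cartesian if $\mathbb X$ has finite products and $T$ preserves them (we identify $T(A\times B)=TA\times TB$). An object $M$ admits negatives if there is $n_M:TM\to TM$ with $n_Mp_M=p_M$ and $\langle\mathrm{id},n_M\rangle s_M=p_Mz_M$.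 If $f:A\to TTM$ satisfies $f\,Tp_M=f\,p_{TM}p_Mz_M$, then $\{f\}:A\to TM$ denotes the unique map with $f=\langle f p_{TM}z_{TM},\{f\}l_M\rangle\,Ts_M$. Lie groups. A group object $G$ has unit $\mathsf e:*\to G$, multiplication $\mathsf m_G$, inverse $\mathsf i_G$. It is a Lie group if the pullback $T_{\mathsf e}G$ of $p_G$ along $\mathsf e$ (with inclusion $\iota_{\mathsf e}:T_{\mathsf e}G\to TG$) exists and is preserved by all $T^n$. A Lie group always admits negatives (known); so does $TG$, with negation $n_{TG}=c_G\,Tn_G\,c_G$. Lie functor. An $A$-PLIVF on $G$ is a map $X:G\times A\to TG$ with $Xp_G=\pi_1$ and $(\mathsf m_G\times\mathrm{id}_A)X=(z_G\times X)\,T\mathsf m_G$. $\mathfrak g(A)$ is the set of $A$-PLIVFs and $\mathfrak g(f)(X)=(\mathrm{id}_G\times f)X$ for $f:A\to B$; the contravariant functor $\mathfrak g(-)$ is the Lie functor of $G$. For a Lie group it is representable: there are an object $\mathfrak g$ (namely $T_{\mathsf e}G$) and a natural isomorphism $\varphi_A:\mathfrak g(A)\cong\mathbb X(A,\mathfrak g)$. The universal PLIVF is $\omega=\varphi_{\mathfrak g}^{-1}(\mathrm{id}_{\mathfrak g})$; explicitly $\omega=(z_G\times\iota_{\mathsf e})\,T\mathsf m_G$. Each $A$-PLIVF $X$ is $(\mathrm{id}_G\times\hat X)\omega$ for a unique $\hat X:A\to\mathfrak g$, the morphism corresponding to $X$. Each $\mathfrak g(A)$ is a Lie algebra (over $\mathbb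 Z$) with zero $\pi_1z_G$, sum $X+Y=\langle X,Y\rangle s_G$ and bracket $[X,Y]=\{\langle X,\pi_2z_A\rangle\,TY-\langle Y,\pi_2z_A\rangle\,TX\,c_G\}$, where for $f,g:B\to TTG$ with $fp_{TG}=gp_{TG}$ one puts $f-g=\langle f,g\,n_{TG}\rangle s_{TG}$. (This is the Lie algebra of left-invariant vector fields on $G$ in the coKleisli tangent category of the comonad $(-)\times A$.) A Lie algebra object in a Cartesian category is a commutative monoid object $(\mathfrak g,0,+)$ with a map $[,]:\mathfrak g\times\mathfrak g\to\mathfrak g$ which is additive in the first variable ($[0,y]=0$, $[x+x',y]=[x,y]+[x',y]$ for generalized elements), antisymmetric ($[x,y]+[y,x]=0$) and satisfies the Jacobi identity $[[x,y],w]+[[y,w],x]+[[w,x],y]=0$. *)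

(* Defs.v *)
From mathcomp Require Import all_boot.
From Stdlib Require Import ProofIrrelevance.

Set Implicit Arguments.
Unset Strict Implicit.
Unset Printing Implicit Defensive.

(* Universal properties below are structures carrying their mediating maps;
   these maps are unique, so the structures are unique when they exist. *)

Record category := Category {
  Ob :> Type;
  Hom : Ob -> Ob -> Type;
  idm : forall A, Hom A A;
  comp : forall A B D, Hom A B -> Hom B D -> Hom A D;
  comp1m : forall A B (f : Hom A B), comp (idm A) f = f;
  compm1 : forall A B (f : Hom A B), comp f (idm B) = f;
  compA : forall A B D E (f : Hom A B) (g : Hom B D) (h : Hom D E),
    comp f (comp g h) = comp (comp f g) h }.

Arguments Hom {c} _ _.
Arguments idm {c} A.
Arguments comp {c A B D} _ _.

(* Diagrammatic order: [f · g] is first [f], then [g]. *)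
Notation "f · g" := (comp f g) (at level 40, left associativity).

Record functor (C D : category) := Functor {
  fob :> C -> D;
  fmap : forall A B, Hom A B -> Hom (fob A) (fob B);
  fmap1 : forall A, fmap (idm A) = idm (fob A);
  fmapM : forall A B E (f : Hom A B) (g : Hom B E),
    fmap (f · g) = fmap f · fmap g }.

Arguments fmap {C D} F {A B} _ : rename.

Notation "F # f" := (fmap F f) (at level 30, right associativity).

Definition idF (C : category) : functor C C :=
  @Functor C C (fun A => A) (fun A B f => f)
    (fun A => erefl) (fun A B E f g => erefl).

Definition compF (C D E : category) (F : functor C D) (G : functor D E) :
  functor C E.
Proof.
exists (fun A => G (F A)) (fun A B f => G # F # f).
- by move=> A; rewrite !fmap1.
- by move=> A B K f g; rewrite !fmapM.
Defined.

Fixpoint iterF (C : category) (F : functor C C) (k : nat) : functor C C :=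
  if k is k'.+1 then compF (iterF F k') F else idF C.

Section Limits.
Context {C : category}.

Record is_terminal (I : C) := IsTerminal {
  bang : forall X, Hom X I;
  bang_uniq : forall X (f g : Hom X I), f = g }.

Record is_product (A B P : C) (p1 : Hom P A) (p2 : Hom P B) := IsProduct {
  prod_med : forall X, Hom X A -> Hom X B -> Hom X P;
  prod_med1 : forall X (f : Hom X A) (g : Hom X B), prod_med f g · p1 = f;
  prod_med2 : forall X (f : Hom X A) (g : Hom X B), prod_med f g · p2 = g;
  prod_uniq : forall X (h k : Hom X P),
    h · p1 = k · p1 -> h · p2 = k · p2 -> h = k }.

Record is_pullback (A B M : C) (f : Hom A M) (g : Hom B M)
    (P : C) (u : Hom P A) (v : Hom P B) := IsPullback {
  pb_comm : u · f = v · g;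
  pb_med : forall X (a : Hom X A) (b : Hom X B), a · f = b · g -> Hom X P;
  pb_med1 : forall X (a : Hom X A) (b : Hom X B) (H : a · f = b · g),
    pb_med H · u = a;
  pb_med2 : forall X (a : Hom X A) (b : Hom X B) (H : a · f = b · g),
    pb_med H · v = b;
  pb_uniq : forall X (h k : Hom X P),
    h · u = k · u -> h · v = k · v -> h = k }.

(* [P] is the [n]-fold pullback of [f] along itself, with structure map [q] to
   the base and projections [pr]; for [n = 0] this says that [q] is an
   isomorphism. *)
Record is_fibre_power (n : nat) (E M : C) (f : Hom E M)
    (P : C) (q : Hom P M) (pr : 'I_n -> Hom P E) := IsFibrePower {
  fp_comm : forall i, pr i · f = q;
  fp_med : forall X (r : Hom X M) (g : 'I_n -> Hom X E),
    (forall i, g i · f = r) -> Hom X P;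
  fp_medq : forall X (r : Hom X M) (g : 'I_n -> Hom X E)
    (H : forall i, g i · f = r), fp_med H · q = r;
  fp_medpr : forall X (r : Hom X M) (g : 'I_n -> Hom X E)
    (H : forall i, g i · f = r) i, fp_med H · pr i = g i;
  fp_uniq : forall X (h k : Hom X P),
    h · q = k · q -> (forall i, h · pr i = k · pr i) -> h = k }.

Definition pick2 (S : Type) (x y : S) (i : 'I_2) : S :=
  if i == ord0 then x else y.

Lemma pick2_comm (E M X : C) (p : Hom E M) (f g : Hom X E)
  (H : f · p = g · p) i : pick2 f g i · p = f · p.
Proof. by rewrite /pick2; case: ifP. Qed.

Definition fpair (E M P : C) (p : Hom E M) (q : Hom P M)
    (pr : 'I_2 -> Hom P E) (lim : is_fibre_power p q pr)
    (X : C) (f g : Hom X E) (H : f · p = g · p) : Hom X P :=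
  fp_med lim (pick2_comm H).

(* The map [f x ... x f] induced between [n]-fold pullbacks. *)
Lemma fpmap_comm n (E M P E' M' : C) (p : Hom E M) (q : Hom P M)
    (pr : 'I_n -> Hom P E) (lim : is_fibre_power p q pr) (p' : Hom E' M')
    (f : Hom E E') (g : Hom M M') (H : f · p' = p · g) i :
  pr i · f · p' = q · g.
Proof. by rewrite -compA H compA (fp_comm lim). Qed.

Definition fpmap n (E M P E' M' P' : C) (p : Hom E M) (q : Hom P M)
    (pr : 'I_n -> Hom P E) (lim : is_fibre_power p q pr)
    (p' : Hom E' M') (q' : Hom P' M') (pr' : 'I_n -> Hom P' E')
    (lim' : is_fibre_power p' q' pr')
    (f : Hom E E') (g : Hom M M') (H : f · p' = p · g) : Hom P P' :=
  fp_med lim' (fpmap_comm lim H).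

(* The data of an additive bundle. *)
Record bundle := Bundle {
  bbase : C;
  btot : C;
  bproj : Hom btot bbase;
  bzero : Hom bbase btot;
  bpow : C;
  bpowq : Hom bpow bbase;
  bpowpr : 'I_2 -> Hom bpow btot;
  bpow_lim : is_fibre_power bproj bpowq bpowpr;
  badd : Hom bpow btot }.

Definition bsum (B : bundle) (X : C) (f g : Hom X (btot B))
    (H : f · bproj B = g · bproj B) : Hom X (btot B) :=
  fpair (bpow_lim B) H · badd B.

(* A commutative monoid in the slice over the base. The monoid laws are stated
   on generalized elements; the compatibility hypotheses of the sums that occur
   in them are consequences of [badd_proj] and [bzero_proj]. *)
Record is_additive_bundle (B : bundle) : Prop := IsAdditiveBundle {
  badd_proj : badd B · bproj B = bpowq B;
  bzero_proj : bzero B · bproj B = idm (bbase B);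
  bsum0 : forall X (f : Hom X (btot B))
    (H : f · bproj B = f · bproj B · bzero B · bproj B), bsum H = f;
  bsumC : forall X (f g : Hom X (btot B))
    (H : f · bproj B = g · bproj B) (H' : g · bproj B = f · bproj B),
    bsum H = bsum H';
  bsumA : forall X (f g h : Hom X (btot B))
    (Hfg : f · bproj B = g · bproj B) (Hgh : g · bproj B = h · bproj B)
    (H1 : f · bproj B = bsum Hgh · bproj B)
    (H2 : bsum Hfg · bproj B = h · bproj B), bsum H1 = bsum H2 }.

(* [f] is the map of total spaces, [g] the map of bases. *)
Record is_additive_morphism (B B' : bundle)
    (f : Hom (btot B) (btot B')) (g : Hom (bbase B) (bbase B')) : Prop :=
  IsAdditiveMorphism {
  am_proj : f · bproj B' = bproj B · g;
  am_zero : bzero B · f = g · bzero B';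
  am_add : badd B · f = fpmap (bpow_lim B) (bpow_lim B') am_proj · badd B' }.

End Limits.

Arguments bundle : clear implicits.

Record tangent_base (C : category) := TangentBase {
  tanT :> functor C C;
  tp : forall M, Hom (tanT M) M;
  tp_nat : forall M N (f : Hom M N), tanT # f · tp N = tp M · f;
  tpow : nat -> C -> C;
  tpowq : forall n M, Hom (tpow n M) M;
  tpowpr : forall n M, 'I_n -> Hom (tpow n M) (tanT M);
  tpow_lim : forall k n M,
    is_fibre_power (iterF tanT k # tp M) (iterF tanT k # tpowq n M)
      (fun i => iterF tanT k # @tpowpr n M i) }.

Arguments tp {C} t M.
Arguments tpowq {C} t n M.
Arguments tpowpr {C} t n M _.

Section TangentBase.
Context (C : category) (T : tangent_base C).

Definition T2_lim M : is_fibre_power (tp T M) (tpowq T 2 M) (tpowpr T 2 M) :=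
  tpow_lim T 0 2 M.

Definition TT2_lim M : is_fibre_power (T # tp T M) (T # tpowq T 2 M)
    (fun i => T # tpowpr T 2 M i) :=
  tpow_lim T 1 2 M.

Definition T2map M N (f : Hom M N) : Hom (tpow T 2 M) (tpow T 2 N) :=
  fpmap (T2_lim M) (T2_lim N) (tp_nat T f).

End TangentBase.

Record tangent_data (C : category) := TangentData {
  tbase :> tangent_base C;
  tz : forall M, Hom M (tbase M);
  ts : forall M, Hom (tpow tbase 2 M) (tbase M);
  tl : forall M, Hom (tbase M) (tbase (tbase M));
  tc : forall M, Hom (tbase (tbase M)) (tbase (tbase M));
  tz_nat : forall M N (f : Hom M N), f · tz N = tz M · tbase # f;
  ts_nat : forall M N (f : Hom M N), T2map tbase f · ts N = ts M · tbase # f;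
  tl_nat : forall M N (f : Hom M N),
    tbase # f · tl N = tl M · tbase # tbase # f;
  tc_nat : forall M N (f : Hom M N),
    tbase # tbase # f · tc N = tc M · tbase # tbase # f }.

Arguments tz {C} t M.
Arguments ts {C} t M.
Arguments tl {C} t M.
Arguments tc {C} t M.

Section TangentData.
Context (C : category) (T : tangent_data C).

(* [(p_M, z_M, s_M)] *)
Definition tbundle (M : C) : bundle C :=
  Bundle (tz T M) (T2_lim T M) (ts T M).

(* [(T p_M, T z_M, T s_M)] *)
Definition Ttbundle (M : C) : bundle C :=
  Bundle (T # tz T M) (TT2_lim T M) (T # ts T M).

Lemma xi_comm M (H : tl T M · T # tp T M = tp T M · tz T M) :
  tpowpr T 2 M ord0 · tz T (T M) · T # tp T M
  = tpowpr T 2 M ord_max · tl T M · T # tp T M.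
Proof.
by rewrite -compA -tz_nat compA (fp_comm (T2_lim T M)) -compA H compA
  (fp_comm (T2_lim T M)).
Qed.

Definition xi M (H : tl T M · T # tp T M = tp T M · tz T M) :
    Hom (tpow T 2 M) (T (T M)) :=
  fpair (TT2_lim T M) (xi_comm H) · T # ts T M.

End TangentData.

Record tangent (C : category) := Tangent {
  tdata :> tangent_data C;
  t_additive : forall M, is_additive_bundle (tbundle tdata M);
  tl_additive : forall M,
    is_additive_morphism (B := tbundle tdata M) (B' := Ttbundle tdata M)
      (tl tdata M) (tz tdata M);
  tc_additive : forall M,
    is_additive_morphism (B := tbundle tdata (tdata M))
      (B' := Ttbundle tdata M) (tc tdata M) (idm (tdata M));
  tl_coassoc : forall M, tl tdata M · tdata # tl tdata M
    = tl tdata M · tl tdata (tdata M);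
  tcK : forall M, tc tdata M · tc tdata M = idm (tdata (tdata M));
  tc_braid : forall M,
    tdata # tc tdata M · tc tdata (tdata M) · tdata # tc tdata M
    = tc tdata (tdata M) · tdata # tc tdata M · tc tdata (tdata M);
  tl_tc : forall M, tl tdata M · tc tdata M = tl tdata M;
  tl_tc_tc : forall M,
    tl tdata (tdata M) · tdata # tc tdata M · tc tdata (tdata M)
    = tc tdata M · tdata # tl tdata M;
  tl_univ : forall M,
    is_pullback (tdata # tp tdata M) (tz tdata M)
      (xi (am_proj (tl_additive M))) (tpowpr tdata 2 M ord0 · tp tdata M) }.

Record cartesian (C : category) := Cartesian {
  one : C;
  one_terminal : is_terminal one;
  pro : C -> C -> C;
  pi1 : forall A B, Hom (pro A B) A;
  pi2 : forall A B, Hom (pro A B) B;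
  pro_product : forall A B, is_product (pi1 A B) (pi2 A B) }.

Record cartesian_tangent (C : category) := CartesianTangent {
  ct_cart :> cartesian C;
  ct_tan :> tangent C;
  T_one : is_terminal (ct_tan (one ct_cart));
  T_pro : forall A B,
    is_product (ct_tan # pi1 ct_cart A B) (ct_tan # pi2 ct_cart A B) }.

Definition mpair (C : category) (K : cartesian C) (X A B : C)
    (f : Hom X A) (g : Hom X B) : Hom X (pro K A B) :=
  prod_med (pro_product K A B) f g.

Definition to_one (C : category) (K : cartesian C) (X : C) :
    Hom X (one K) := bang (one_terminal K) X.

Arguments pi1 {C c A B}.
Arguments pi2 {C c A B}.
Arguments mpair {C K X A B} f g.
Arguments to_one {C} K X.

Notation "⟨ f , g ⟩" := (mpair f g) (at level 0, format "⟨ f ,  g ⟩").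

Section LieAlgebraObject.
Context (C : category) (K : cartesian C).

(* The laws are stated on generalized elements. *)
Record is_lie_algebra_object (A : C) (zero : Hom (one K) A)
    (add br : Hom (pro K A A) A) : Prop := IsLieAlgebraObject {
  la_add0 : forall X (x : Hom X A), ⟨x, to_one K X · zero⟩ · add = x;
  la_addC : forall X (x y : Hom X A), ⟨x, y⟩ · add = ⟨y, x⟩ · add;
  la_addA : forall X (x y w : Hom X A),
    ⟨x, ⟨y, w⟩ · add⟩ · add = ⟨⟨x, y⟩ · add, w⟩ · add;
  la_br0 : forall X (y : Hom X A),
    ⟨to_one K X · zero, y⟩ · br = to_one K X · zero;
  la_brD : forall X (x x' y : Hom X A),
    ⟨⟨x, x'⟩ · add, y⟩ · br = ⟨⟨x, y⟩ · br, ⟨x', y⟩ · br⟩ · add;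
  la_antisym : forall X (x y : Hom X A),
    ⟨⟨x, y⟩ · br, ⟨y, x⟩ · br⟩ · add = to_one K X · zero;
  la_jacobi : forall X (x y w : Hom X A),
    ⟨⟨⟨⟨x, y⟩ · br, w⟩ · br, ⟨⟨y, w⟩ · br, x⟩ · br⟩ · add,
     ⟨⟨w, x⟩ · br, y⟩ · br⟩ · add = to_one K X · zero }.

Record group_object := GroupObject {
  gcar :> C;
  gunit : Hom (one K) gcar;
  gmul : Hom (pro K gcar gcar) gcar;
  ginv : Hom gcar gcar;
  gmulA : ⟨pi1, pi2 · gmul⟩ · gmul
    = ⟨⟨pi1, pi2 · pi1⟩ · gmul, pi2 · pi2⟩ · gmul
    :> Hom (pro K gcar (pro K gcar gcar)) gcar;
  gmul1g : ⟨to_one K gcar · gunit, idm gcar⟩ · gmul = idm gcar;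
  gmulg1 : ⟨idm gcar, to_one K gcar · gunit⟩ · gmul = idm gcar;
  gmulVg : ⟨ginv, idm gcar⟩ · gmul = to_one K gcar · gunit;
  gmulgV : ⟨idm gcar, ginv⟩ · gmul = to_one K gcar · gunit }.

End LieAlgebraObject.

Arguments gunit {C K} g.
Arguments gmul {C K} g.
Arguments ginv {C K} g.

Record lie_group (C : category) (T : cartesian_tangent C) := LieGroup {
  lgroup :> group_object T;
  TeG : C;
  TeG_incl : Hom TeG (T lgroup);
  TeG_lim : forall k,
    is_pullback (iterF T k # tp T lgroup) (iterF T k # gunit lgroup)
      (iterF T k # TeG_incl) (iterF T k # to_one T TeG) }.

Arguments TeG {C T} l.
Arguments TeG_incl {C T} l.

Section Sums.
Context (C : category) (T : tangent C).

Definition addT M (X : C) (f g : Hom X (T M))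
    (H : f · tp T M = g · tp T M) : Hom X (T M) :=
  fpair (T2_lim T M) H · ts T M.

Definition addTT M (X : C) (f g : Hom X (T (T M)))
    (H : f · T # tp T M = g · T # tp T M) : Hom X (T (T M)) :=
  fpair (TT2_lim T M) H · T # ts T M.

Definition is_negation M (n : Hom (T M) (T M)) : Prop :=
  exists H : n · tp T M = tp T M,
    addT (etrans (comp1m _) (esym H)) = tp T M · tz T M.

End Sums.

Section Products.
Context (C : category) (K : cartesian C).

Lemma mpair1 (X A B : C) (f : Hom X A) (g : Hom X B) :
  ⟨f, g⟩ · pi1 (c := K) = f.
Proof. exact: (prod_med1 (pro_product K A B)). Qed.

Lemma mpair2 (X A B : C) (f : Hom X A) (g : Hom X B) :
  ⟨f, g⟩ · pi2 (c := K) = g.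
Proof. exact: (prod_med2 (pro_product K A B)). Qed.

Lemma pro_ext (X A B : C) (h k : Hom X (pro K A B)) :
  h · pi1 = k · pi1 -> h · pi2 = k · pi2 -> h = k.
Proof. exact: (prod_uniq (pro_product K A B)). Qed.

Lemma comp_mpair (X Y A B : C) (h : Hom Y X) (f : Hom X A) (g : Hom X B) :
  h · ⟨f, g⟩ = ⟨h · f, h · g⟩ :> Hom Y (pro K A B).
Proof. by apply: pro_ext; rewrite -compA ?mpair1 ?mpair2. Qed.

Lemma to_one_uniq (X : C) (f g : Hom X (one K)) : f = g.
Proof. exact: (bang_uniq (one_terminal K)). Qed.

End Products.

Section Powers.
Context (C : category).

Lemma fpair1 (E M P : C) (p : Hom E M) (q : Hom P M)
    (pr : 'I_2 -> Hom P E) (lim : is_fibre_power p q pr)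
    (X : C) (f g : Hom X E) (H : f · p = g · p) :
  fpair lim H · pr ord0 = f.
Proof. by rewrite /fpair fp_medpr. Qed.

Lemma fpair2 (E M P : C) (p : Hom E M) (q : Hom P M)
    (pr : 'I_2 -> Hom P E) (lim : is_fibre_power p q pr)
    (X : C) (f g : Hom X E) (H : f · p = g · p) :
  fpair lim H · pr ord_max = g.
Proof. by rewrite /fpair fp_medpr. Qed.

Lemma fpairq (E M P : C) (p : Hom E M) (q : Hom P M)
    (pr : 'I_2 -> Hom P E) (lim : is_fibre_power p q pr)
    (X : C) (f g : Hom X E) (H : f · p = g · p) :
  fpair lim H · q = f · p.
Proof. by rewrite /fpair fp_medq. Qed.

Lemma fpow2_ext (E M P : C) (p : Hom E M) (q : Hom P M)
    (pr : 'I_2 -> Hom P E) (lim : is_fibre_power p q pr)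
    (X : C) (h k : Hom X P) :
  h · pr ord0 = k · pr ord0 -> h · pr ord_max = k · pr ord_max -> h = k.
Proof.
move=> h0 h1; apply: (fp_uniq lim).
  by rewrite -!(fp_comm lim ord0) !compA h0.
by case=> [[|[|//]] Hi]; [have -> : Ordinal Hi = ord0 by apply: val_inj
  | have -> : Ordinal Hi = ord_max by apply: val_inj].
Qed.

Lemma fpmap_pr n (E M P E' M' P' : C) (p : Hom E M) (q : Hom P M)
    (pr : 'I_n -> Hom P E) (lim : is_fibre_power p q pr)
    (p' : Hom E' M') (q' : Hom P' M') (pr' : 'I_n -> Hom P' E')
    (lim' : is_fibre_power p' q' pr')
    (f : Hom E E') (g : Hom M M') (H : f · p' = p · g) i :
  fpmap lim lim' H · pr' i = pr i · f.
Proof. exact: (fp_medpr lim'). Qed.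

Lemma fpair_fpmap (E M P E' M' P' : C) (p : Hom E M) (q : Hom P M)
    (pr : 'I_2 -> Hom P E) (lim : is_fibre_power p q pr)
    (p' : Hom E' M') (q' : Hom P' M') (pr' : 'I_2 -> Hom P' E')
    (lim' : is_fibre_power p' q' pr')
    (f : Hom E E') (g : Hom M M') (H : f · p' = p · g)
    (X : C) (a b : Hom X E) (Hab : a · p = b · p)
    (Hab' : a · f · p' = b · f · p') :
  fpair lim Hab · fpmap lim lim' H = fpair lim' Hab'.
Proof.
by apply: (fpow2_ext lim'); rewrite -compA fpmap_pr compA ?fpair1 ?fpair2.
Qed.

Lemma comp_fpair (E M P : C) (p : Hom E M) (q : Hom P M)
    (pr : 'I_2 -> Hom P E) (lim : is_fibre_power p q pr)
    (X Y : C) (h : Hom Y X) (f g : Hom X E) (H : f · p = g · p)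
    (H' : h · f · p = h · g · p) :
  h · fpair lim H = fpair lim H'.
Proof. by apply: (fpow2_ext lim); rewrite -compA ?fpair1 ?fpair2. Qed.

Lemma fpair_congr (E M P : C) (p : Hom E M) (q : Hom P M)
    (pr : 'I_2 -> Hom P E) (lim : is_fibre_power p q pr)
    (X : C) (f g f' g' : Hom X E) (H : f · p = g · p) (H' : f' · p = g' · p) :
  f = f' -> g = g' -> fpair lim H = fpair lim H'.
Proof.
by move=> ef eg; apply: (fpow2_ext lim); rewrite ?fpair1 ?fpair2.
Qed.

End Powers.

Section SumLemmas.
Context (C : category) (T : tangent C).

Lemma addT_congr M (X : C) (f g f' g' : Hom X (T M))
    (H : f · tp T M = g · tp T M) (H' : f' · tp T M = g' · tp T M) :
  f = f' -> g = g' -> addT H = addT H'.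
Proof. by move=> ef eg; rewrite /addT (fpair_congr _ H H' ef eg). Qed.

Lemma addTT_congr M (X : C) (f g f' g' : Hom X (T (T M)))
    (H : f · T # tp T M = g · T # tp T M)
    (H' : f' · T # tp T M = g' · T # tp T M) :
  f = f' -> g = g' -> addTT H = addTT H'.
Proof. by move=> ef eg; rewrite /addTT (fpair_congr _ H H' ef eg). Qed.

Lemma comp_addT M (X Y : C) (h : Hom Y X) (f g : Hom X (T M))
    (H : f · tp T M = g · tp T M) (H' : h · f · tp T M = h · g · tp T M) :
  h · addT H = addT H'.
Proof. by rewrite /addT compA (comp_fpair _ _ H'). Qed.

Lemma comp_addTT M (X Y : C) (h : Hom Y X) (f g : Hom X (T (T M)))
    (H : f · T # tp T M = g · T # tp T M)
    (H' : h · f · T # tp T M = h · g · T # tp T M) :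
  h · addTT H = addTT H'.
Proof. by rewrite /addTT compA (comp_fpair _ _ H'). Qed.

Lemma addT_p M (X : C) (f g : Hom X (T M)) (H : f · tp T M = g · tp T M) :
  addT H · tp T M = f · tp T M.
Proof.
by rewrite /addT -compA (badd_proj (t_additive T M)) fpairq.
Qed.

Lemma addT_nat_comm M N (k : Hom M N) (X : C) (f g : Hom X (T M))
    (H : f · tp T M = g · tp T M) :
  f · T # k · tp T N = g · T # k · tp T N.
Proof. by rewrite -!compA tp_nat !compA H. Qed.

Lemma addT_nat M N (k : Hom M N) (X : C) (f g : Hom X (T M))
    (H : f · tp T M = g · tp T M)
    (H' : f · T # k · tp T N = g · T # k · tp T N) :
  addT H · T # k = addT H'.
Proof.
by rewrite /addT -compA -ts_nat compA /T2map (fpair_fpmap _ _ _ _ H').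
Qed.

Lemma addT0 M (X : C) (f g : Hom X (T M)) (H : f · tp T M = g · tp T M) :
  g = f · tp T M · tz T M -> addT H = f.
Proof.
move=> eg.
have H' : f · tp T M = f · tp T M · tz T M · tp T M by rewrite -eg H.
by rewrite (addT_congr H H' erefl eg); apply: (bsum0 (t_additive T M) H').
Qed.

Lemma addTC M (X : C) (f g : Hom X (T M)) (H : f · tp T M = g · tp T M)
    (H' : g · tp T M = f · tp T M) : addT H = addT H'.
Proof. exact: (bsumC (t_additive T M)). Qed.

Lemma addTA M (X : C) (f g h : Hom X (T M))
    (Hfg : f · tp T M = g · tp T M) (Hgh : g · tp T M = h · tp T M)
    (H1 : f · tp T M = addT Hgh · tp T M)
    (H2 : addT Hfg · tp T M = h · tp T M) : addT H1 = addT H2.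
Proof. exact: (bsumA (t_additive T M)). Qed.

Lemma tzp M : tz T M · tp T M = idm M.
Proof. exact: (bzero_proj (t_additive T M)). Qed.

Lemma addT_inv_uniq M (X : C) (f g h : Hom X (T M))
    (Hg : f · tp T M = g · tp T M) (Hh : f · tp T M = h · tp T M) :
  addT Hg = f · tp T M · tz T M -> addT Hh = f · tp T M · tz T M -> g = h.
Proof.
move=> eg eh.
have Hgf : g · tp T M = f · tp T M by [].
have K1 : g · tp T M = addT Hh · tp T M by rewrite addT_p -Hg.
have K2 : addT Hgf · tp T M = h · tp T M by rewrite addT_p -Hg.
have H0 : addT K1 = g by apply: addT0; rewrite eh Hg.
have H1 : h · tp T M = addT Hgf · tp T M by rewrite K2.
have H2 : addT H1 = h.
  by apply: addT0; rewrite (addTC Hgf Hg) eg Hh.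
by rewrite -H0 (addTA K1 K2) (addTC K2 H1).
Qed.

Lemma tcp M : tc T M · tp T (T M) = T # tp T M.
Proof.
have /= E := am_proj (tc_additive T M); rewrite compm1 in E.
by rewrite -E compA tcK comp1m.
Qed.

Lemma tcTp M : tc T M · T # tp T M = tp T (T M).
Proof. by have /= := am_proj (tc_additive T M); rewrite compm1. Qed.

Lemma tzc M : tz T (T M) · tc T M = T # tz T M.
Proof. by have /= := am_zero (tc_additive T M); rewrite comp1m. Qed.

Lemma tlTp M : tl T M · T # tp T M = tp T M · tz T M.
Proof. exact: (am_proj (tl_additive T M)). Qed.

Lemma tlp M : tl T M · tp T (T M) = tp T M · tz T M.
Proof. by rewrite -tcTp compA tl_tc tlTp. Qed.

Lemma tzl M : tz T M · tl T M = tz T M · T # tz T M.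
Proof. exact: (am_zero (tl_additive T M)). Qed.

Lemma addTT_Tp M (X : C) (f g : Hom X (T (T M)))
    (H : f · T # tp T M = g · T # tp T M) :
  addTT H · T # tp T M = f · T # tp T M.
Proof.
rewrite /addTT -compA -fmapM (badd_proj (t_additive T M)).
exact: (fpairq (TT2_lim T M)).
Qed.

Lemma addTT_p_comm M (X : C) (f g : Hom X (T (T M)))
    (H : f · T # tp T M = g · T # tp T M) :
  f · tp T (T M) · tp T M = g · tp T (T M) · tp T M.
Proof. by rewrite -!compA -!(tp_nat T (tp T M)) !compA H. Qed.

Lemma addTT_p M (X : C) (f g : Hom X (T (T M)))
    (H : f · T # tp T M = g · T # tp T M)
    (H' : f · tp T (T M) · tp T M = g · tp T (T M) · tp T M) :
  addTT H · tp T (T M) = addT H'.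
Proof.
rewrite /addTT /addT -compA tp_nat compA; congr (_ · _).
by apply: (fpow2_ext (T2_lim T M)); rewrite -compA -tp_nat compA
  ?(fpair1 (TT2_lim T M)) ?(fpair2 (TT2_lim T M)) ?fpair1 ?fpair2.
Qed.

Lemma addTT0 M (X : C) (f g : Hom X (T (T M)))
    (H : f · T # tp T M = g · T # tp T M) :
  g = f · T # tp T M · T # tz T M -> addTT H = f.
Proof.
move=> eg; rewrite /addTT.
have H0 : idm (T M) · tp T M = tp T M · tz T M · tp T M.
  by rewrite -compA tzp comp1m compm1.
have -> : fpair (TT2_lim T M) H = f · T # fpair (T2_lim T M) H0.
  apply: (fpow2_ext (TT2_lim T M)).
    rewrite (fpair1 (TT2_lim T M)) -compA -fmapM.
    by rewrite (fpair1 (T2_lim T M)) fmap1 compm1.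
  rewrite (fpair2 (TT2_lim T M)) -compA -fmapM.
  by rewrite (fpair2 (T2_lim T M)) fmapM compA.
rewrite -compA -fmapM.
have -> : fpair (T2_lim T M) H0 · ts T M = idm (T M).
  by apply: (addT0 H0); rewrite comp1m.
by rewrite fmap1 compm1.
Qed.

Lemma addTT_nat M N (k : Hom M N) (X : C) (f g : Hom X (T (T M)))
    (H : f · T # tp T M = g · T # tp T M)
    (H' : f · T # T # k · T # tp T N = g · T # T # k · T # tp T N) :
  addTT H · T # T # k = addTT H'.
Proof.
rewrite /addTT -compA -fmapM -ts_nat fmapM compA; congr (_ · _).
apply: (fpow2_ext (TT2_lim T N)); rewrite -compA -fmapM fpmap_pr fmapM compA.
  by rewrite (fpair1 (TT2_lim T M)) (fpair1 (TT2_lim T N)).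
by rewrite (fpair2 (TT2_lim T M)) (fpair2 (TT2_lim T N)).
Qed.

(* The operation [{f}]. *)
Definition lift M (X : C) (f : Hom X (T (T M)))
    (H : f · T # tp T M = f · tp T (T M) · tp T M · tz T M) : Hom X (T M) :=
  pb_med (tl_univ T M) H · tpowpr T 2 M ord_max.

Lemma comp_xi M (X : C) (h : Hom X (tpow T 2 M))
    (H : h · tpowpr T 2 M ord0 · tz T (T M) · T # tp T M
       = h · tpowpr T 2 M ord_max · tl T M · T # tp T M) :
  h · xi (am_proj (tl_additive T M)) = addTT H.
Proof.
rewrite /xi compA /addTT; congr (_ · _).
by apply: (fpow2_ext (TT2_lim T M)); rewrite -compA
  ?(fpair1 (TT2_lim T M)) ?(fpair2 (TT2_lim T M)) compA.
Qed.

Lemma xi_Tp M (X : C) (u v : Hom X (T M)) (H : u · tp T M = v · tp T M) :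
  u · tz T (T M) · T # tp T M = v · tl T M · T # tp T M.
Proof. by rewrite -!compA -tz_nat tlTp !compA H. Qed.

Lemma xi_p M (X : C) (u v : Hom X (T M))
    (H : u · tz T (T M) · T # tp T M = v · tl T M · T # tp T M) :
  u · tp T M = v · tp T M -> addTT H · tp T (T M) = u.
Proof.
move=> Huv.
have Ez : u · tz T (T M) · tp T (T M) = u by rewrite -compA tzp compm1.
rewrite (addTT_p H (addTT_p_comm H)) (addT0 (addTT_p_comm H)) ?Ez //.
by rewrite -compA tlp !compA Huv.
Qed.

Lemma lift_p M (X : C) (f : Hom X (T (T M)))
    (H : f · T # tp T M = f · tp T (T M) · tp T M · tz T M) :
  lift H · tp T M = f · tp T (T M) · tp T M.
Proof.
rewrite -[RHS](pb_med2 (tl_univ T M) H) /lift -compA; congr (_ · _).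
by rewrite !(fp_comm (T2_lim T M)).
Qed.

Lemma lift_spec M (X : C) (f : Hom X (T (T M)))
    (H : f · T # tp T M = f · tp T (T M) · tp T M · tz T M)
    (H' : f · tp T (T M) · tz T (T M) · T # tp T M
          = lift H · tl T M · T # tp T M) :
  addTT H' = f.
Proof.
set h := pb_med (tl_univ T M) H.
have Hh : h · tpowpr T 2 M ord0 · tp T M = h · tpowpr T 2 M ord_max · tp T M.
  by rewrite -!compA !(fp_comm (T2_lim T M)).
have K := xi_Tp Hh.
have E := pb_med1 (tl_univ T M) H; rewrite -/h (comp_xi K) in E.
rewrite -[RHS]E; apply: addTT_congr => //.
by rewrite -[in LHS]E xi_p.
Qed.

Lemma lift_uniq M (X : C) (f : Hom X (T (T M)))
    (H : f · T # tp T M = f · tp T (T M) · tp T M · tz T M)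
    (k : Hom X (T M))
    (H' : f · tp T (T M) · tz T (T M) · T # tp T M = k · tl T M · T # tp T M) :
  addTT H' = f -> k = lift H.
Proof.
move=> E.
have Hk : f · tp T (T M) · tp T M = k · tp T M.
  move: (H'); rewrite -!compA -tz_nat tlTp => /(congr1 (fun x => x · tp T M)).
  by rewrite -!compA tzp !compm1 !compA.
rewrite /lift.
suff <- : fpair (T2_lim T M) Hk = pb_med (tl_univ T M) H by rewrite fpair2.
apply: (pb_uniq (tl_univ T M)).
  rewrite (pb_med1 (tl_univ T M)) -[RHS]E.
  have K : fpair (T2_lim T M) Hk · tpowpr T 2 M ord0 · tz T (T M) · T # tp T M
     = fpair (T2_lim T M) Hk · tpowpr T 2 M ord_max · tl T M · T # tp T M.
    by rewrite fpair1 fpair2.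
  by rewrite (comp_xi K); apply: addTT_congr; rewrite ?fpair1 ?fpair2.
by rewrite (pb_med2 (tl_univ T M)) compA fpair1.
Qed.

Lemma addT_neg M (n : Hom (T M) (T M)) (X : C) (v : Hom X (T M))
    (K : v · tp T M = v · n · tp T M) :
  is_negation n -> addT K = v · tp T M · tz T M.
Proof.
case=> H E; have K1 : v · idm (T M) · tp T M = v · n · tp T M.
  by rewrite compm1.
rewrite -(addT_congr K1 K (compm1 v) erefl).
by rewrite -(comp_addT (etrans (comp1m _) (esym H)) K1) E compA.
Qed.

Lemma negation_uniq M (n n' : Hom (T M) (T M)) :
  is_negation n -> is_negation n' -> n = n'.
Proof.
move=> [H E] [H' E'].
apply: (addT_inv_uniq (Hg := etrans (comp1m _) (esym H))
  (Hh := etrans (comp1m _) (esym H'))); rewrite ?E ?E'.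
  by congr (_ · _); rewrite comp1m.
by congr (_ · _); rewrite comp1m.
Qed.

(* Negation and subtraction on [T (T M)], for [n] a negation on [T M]. *)
Definition negTT M (n : Hom (T M) (T M)) : Hom (T (T M)) (T (T M)) :=
  tc T M · T # n · tc T M.

Lemma negTT_p M (n : Hom (T M) (T M)) :
  n · tp T M = tp T M -> negTT n · tp T (T M) = tp T (T M).
Proof. by move=> H; rewrite /negTT -compA tcp -compA -fmapM H tcTp. Qed.

Lemma tc_negTT_Tp M (n : Hom (T M) (T M)) :
  tc T M · negTT n · T # tp T M = T # n · tp T (T M).
Proof. by rewrite /negTT !compA tcK comp1m -compA tcTp. Qed.

Lemma subTT_comm M (n : Hom (T M) (T M)) (Hn : n · tp T M = tp T M)
    (X : C) (f g : Hom X (T (T M))) (H : f · tp T (T M) = g · tp T (T M)) :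
  f · tp T (T M) = g · negTT n · tp T (T M).
Proof. by rewrite -compA negTT_p. Qed.

Definition subTT M (n : Hom (T M) (T M)) (Hn : n · tp T M = tp T M)
    (X : C) (f g : Hom X (T (T M))) (H : f · tp T (T M) = g · tp T (T M)) :
    Hom X (T (T M)) :=
  addT (subTT_comm Hn H).

End SumLemmas.

Section TangentProducts.
Context (C : category) (T : cartesian_tangent C).

(* The identification of [T A x T B] with [T (A x B)], on pairs. *)
Definition tpair (X A B : C) (f : Hom X (T A)) (g : Hom X (T B)) :
    Hom X (T (pro T A B)) := prod_med (T_pro T A B) f g.

Lemma tpair1 (X A B : C) (f : Hom X (T A)) (g : Hom X (T B)) :
  tpair f g · T # pi1 = f.
Proof. exact: prod_med1. Qed.

Lemma tpair2 (X A B : C) (f : Hom X (T A)) (g : Hom X (T B)) :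
  tpair f g · T # pi2 = g.
Proof. exact: prod_med2. Qed.

Lemma tpro_ext (X A B : C) (h k : Hom X (T (pro T A B))) :
  h · T # pi1 = k · T # pi1 -> h · T # pi2 = k · T # pi2 -> h = k.
Proof. exact: (prod_uniq (T_pro T A B)). Qed.

Lemma comp_tpair (X Y A B : C) (h : Hom Y X) (f : Hom X (T A))
    (g : Hom X (T B)) : h · tpair f g = tpair (h · f) (h · g).
Proof. by apply: tpro_ext; rewrite -compA ?tpair1 ?tpair2. Qed.

Lemma tpair_p (X A B : C) (f : Hom X (T A)) (g : Hom X (T B)) :
  tpair f g · tp T (pro T A B) = ⟨f · tp T A, g · tp T B⟩.
Proof.
by apply: pro_ext; rewrite ?mpair1 ?mpair2 -compA -tp_nat compA
  ?tpair1 ?tpair2.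
Qed.

Lemma mpair_z (X A B : C) (f : Hom X A) (g : Hom X B) :
  ⟨f, g⟩ · tz T (pro T A B) = tpair (f · tz T A) (g · tz T B).
Proof.
by apply: tpro_ext; rewrite ?tpair1 ?tpair2 -compA -tz_nat compA
  ?mpair1 ?mpair2.
Qed.

Lemma comp_Tmpair (X Z A B : C) (h : Hom X (T Z)) (a : Hom Z A)
    (b : Hom Z B) :
  h · T # (⟨a, b⟩ : Hom _ (pro T A B)) = tpair (h · T # a) (h · T # b).
Proof.
by apply: tpro_ext; rewrite ?tpair1 ?tpair2 -compA -fmapM ?mpair1 ?mpair2.
Qed.

Lemma ttpro_ext (X A B : C) (h k : Hom X (T (T (pro T A B)))) :
  h · T # T # pi1 = k · T # T # pi1 ->
  h · T # T # pi2 = k · T # T # pi2 -> h = k.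
Proof.
move=> h1 h2.
have iso : (⟨T # pi1, T # pi2⟩ : Hom (T (pro T A B)) (pro T (T A) (T B)))
    · tpair pi1 pi2 = idm _.
  by apply: tpro_ext; rewrite comp_tpair ?tpair1 ?tpair2 ?mpair1 ?mpair2 comp1m.
rewrite -[h]compm1 -[k]compm1 -fmap1 -iso fmapM !compA; congr (_ · _).
by rewrite !comp_Tmpair h1 h2.
Qed.

Definition ttpair (X A B : C) (f : Hom X (T (T A))) (g : Hom X (T (T B))) :
    Hom X (T (T (pro T A B))) :=
  tpair f g · T # tpair pi1 pi2.

Lemma ttpair1 (X A B : C) (f : Hom X (T (T A))) (g : Hom X (T (T B))) :
  ttpair f g · T # T # pi1 = f.
Proof. by rewrite /ttpair -compA -fmapM tpair1 tpair1. Qed.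

Lemma ttpair2 (X A B : C) (f : Hom X (T (T A))) (g : Hom X (T (T B))) :
  ttpair f g · T # T # pi2 = g.
Proof. by rewrite /ttpair -compA -fmapM tpair2 tpair2. Qed.

Lemma ttpair_p (X A B : C) (f : Hom X (T (T A))) (g : Hom X (T (T B))) :
  ttpair f g · tp T (T (pro T A B)) = tpair (f · tp T (T A)) (g · tp T (T B)).
Proof.
by apply: tpro_ext; rewrite ?tpair1 ?tpair2 -compA -tp_nat compA
  ?ttpair1 ?ttpair2.
Qed.

Lemma tpair_zT (X A B : C) (f : Hom X (T A)) (g : Hom X (T B)) :
  tpair f g · tz T (T (pro T A B)) = ttpair (f · tz T (T A)) (g · tz T (T B)).
Proof.
by apply: ttpro_ext; rewrite ?ttpair1 ?ttpair2 -compA -tz_nat compA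
  ?tpair1 ?tpair2.
Qed.

Lemma tpair_l (X A B : C) (f : Hom X (T A)) (g : Hom X (T B)) :
  tpair f g · tl T (pro T A B) = ttpair (f · tl T A) (g · tl T B).
Proof.
by apply: ttpro_ext; rewrite ?ttpair1 ?ttpair2 -compA -tl_nat compA
  ?tpair1 ?tpair2.
Qed.

Lemma ttpair_c (X A B : C) (f : Hom X (T (T A))) (g : Hom X (T (T B))) :
  ttpair f g · tc T (pro T A B) = ttpair (f · tc T A) (g · tc T B).
Proof.
by apply: ttpro_ext; rewrite ?ttpair1 ?ttpair2 -compA -tc_nat compA
  ?ttpair1 ?ttpair2.
Qed.

Lemma tpair_addT (X A B : C) (f f' : Hom X (T A)) (g g' : Hom X (T B))
    (Hf : f · tp T A = f' · tp T A) (Hg : g · tp T B = g' · tp T B)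
    (H : tpair f g · tp T (pro T A B) = tpair f' g' · tp T (pro T A B)) :
  addT H = tpair (addT Hf) (addT Hg).
Proof.
apply: tpro_ext; rewrite ?tpair1 ?tpair2.
  rewrite (addT_nat _ (addT_nat_comm pi1 H)).
  by apply: addT_congr; rewrite tpair1.
rewrite (addT_nat _ (addT_nat_comm pi2 H)).
by apply: addT_congr; rewrite tpair2.
Qed.

Lemma ttpair_addT (X A B : C) (f f' : Hom X (T (T A))) (g g' : Hom X (T (T B)))
    (Hf : f · tp T (T A) = f' · tp T (T A))
    (Hg : g · tp T (T B) = g' · tp T (T B))
    (H : ttpair f g · tp T (T (pro T A B))
       = ttpair f' g' · tp T (T (pro T A B))) :
  addT H = ttpair (addT Hf) (addT Hg).
Proof.
apply: ttpro_ext; rewrite ?ttpair1 ?ttpair2.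
  rewrite (addT_nat _ (addT_nat_comm (T # pi1) H)).
  by apply: addT_congr; rewrite ttpair1.
rewrite (addT_nat _ (addT_nat_comm (T # pi2) H)).
by apply: addT_congr; rewrite ttpair2.
Qed.

Lemma addTT_nat_comm M N (k : Hom M N) (X : C) (f g : Hom X (T (T M)))
    (H : f · T # tp T M = g · T # tp T M) :
  f · T # T # k · T # tp T N = g · T # T # k · T # tp T N.
Proof. by rewrite -!compA -fmapM tp_nat fmapM !compA H. Qed.

Lemma ttpair_addTT (X A B : C) (f f' : Hom X (T (T A))) (g g' : Hom X (T (T B)))
    (Hf : f · T # tp T A = f' · T # tp T A)
    (Hg : g · T # tp T B = g' · T # tp T B)
    (H : ttpair f g · T # tp T (pro T A B)
       = ttpair f' g' · T # tp T (pro T A B)) :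
  addTT H = ttpair (addTT Hf) (addTT Hg).
Proof.
apply: ttpro_ext; rewrite ?ttpair1 ?ttpair2.
  rewrite (addTT_nat _ (addTT_nat_comm pi1 H)).
  by apply: addTT_congr; rewrite ttpair1.
rewrite (addTT_nat _ (addTT_nat_comm pi2 H)).
by apply: addTT_congr; rewrite ttpair2.
Qed.

End TangentProducts.

Section GroupTangent.
Context (C : category) (T : cartesian_tangent C) (G : group_object T).

Lemma gmulAe (X : C) (a b c : Hom X G) :
  ⟨⟨a, b⟩ · gmul G, c⟩ · gmul G = ⟨a, ⟨b, c⟩ · gmul G⟩ · gmul G.
Proof.
have E := congr1 (fun x => (⟨a, ⟨b, c⟩⟩ : Hom X (pro T G (pro T G G))) · x)
  (gmulA G).
by rewrite /= !compA !comp_mpair !compA !comp_mpair !compA ?mpair1 ?mpair2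
  ?compA ?mpair1 ?mpair2 in E.
Qed.

Lemma gmule1 (X : C) (a : Hom X G) (u : Hom X (one T)) :
  ⟨a, u · gunit G⟩ · gmul G = a.
Proof.
have E := congr1 (fun x => a · x) (gmulg1 G).
by rewrite /= compA comp_mpair !compA compm1
  (to_one_uniq (a · to_one T G) u) in E.
Qed.

Lemma gmul1e (X : C) (a : Hom X G) (u : Hom X (one T)) :
  ⟨u · gunit G, a⟩ · gmul G = a.
Proof.
have E := congr1 (fun x => a · x) (gmul1g G).
by rewrite /= compA comp_mpair !compA compm1
  (to_one_uniq (a · to_one T G) u) in E.
Qed.

Lemma gmulgVe (X : C) (a : Hom X G) (u : Hom X (one T)) :
  ⟨a, a · ginv G⟩ · gmul G = u · gunit G.
Proof.
have E := congr1 (fun x => a · x) (gmulgV G).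
by rewrite /= compA comp_mpair !compA compm1
  (to_one_uniq (a · to_one T G) u) in E.
Qed.

Lemma gmulVge (X : C) (a : Hom X G) (u : Hom X (one T)) :
  ⟨a · ginv G, a⟩ · gmul G = u · gunit G.
Proof.
have E := congr1 (fun x => a · x) (gmulVg G).
by rewrite /= compA comp_mpair !compA compm1
  (to_one_uniq (a · to_one T G) u) in E.
Qed.

(* The multiplication of the group object [T G]. *)
Definition tmul (X : C) (a b : Hom X (T G)) : Hom X (T G) :=
  tpair a b · T # gmul G.

Lemma comp_tmul (X Y : C) (h : Hom Y X) (a b : Hom X (T G)) :
  h · tmul a b = tmul (h · a) (h · b).
Proof. by rewrite /tmul compA comp_tpair. Qed.

Lemma tmul_p (X : C) (a b : Hom X (T G)) :
  tmul a b · tp T G = ⟨a · tp T G, b · tp T G⟩ · gmul G.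
Proof. by rewrite /tmul -compA tp_nat compA tpair_p. Qed.

Lemma gmul_z (X : C) (a b : Hom X G) :
  ⟨a, b⟩ · gmul G · tz T G = tmul (a · tz T G) (b · tz T G).
Proof. by rewrite /tmul -compA tz_nat compA mpair_z. Qed.

Lemma tmulA (X : C) (a b c : Hom X (T G)) :
  tmul (tmul a b) c = tmul a (tmul b c).
Proof.
have E := congr1 (fun x => (tpair a (tpair b c) :
  Hom X (T (pro T G (pro T G G)))) · T # x) (gmulA G).
rewrite /= !fmapM !compA !comp_Tmpair !fmapM !compA !comp_Tmpair !fmapM in E.
by rewrite !compA ?tpair1 ?tpair2 ?compA ?tpair1 ?tpair2 in E.
Qed.

Lemma tmul1z (X : C) (a : Hom X (T G)) (u : Hom X (one T)) :
  tmul (u · gunit G · tz T G) a = a.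
Proof.
have E := congr1 (fun x => a · T # x) (gmul1g G).
rewrite /= !fmapM !compA !comp_Tmpair fmapM fmap1 compm1 in E.
rewrite -[RHS]E /tmul; congr (tpair _ a · _).
rewrite -compA tz_nat !compA; congr (_ · _).
exact: (bang_uniq (T_one T)).
Qed.

Lemma tmulz1 (X : C) (a : Hom X (T G)) (u : Hom X (one T)) :
  tmul a (u · gunit G · tz T G) = a.
Proof.
have E := congr1 (fun x => a · T # x) (gmulg1 G).
rewrite /= !fmapM !compA !comp_Tmpair fmapM fmap1 compm1 in E.
rewrite -[RHS]E /tmul; congr (tpair a _ · _).
rewrite -compA tz_nat !compA; congr (_ · _).
exact: (bang_uniq (T_one T)).
Qed.

Lemma tmulV (X : C) (a : Hom X (T G)) :
  tmul a (a · T # ginv G) = to_one T X · gunit G · tz T G.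
Proof.
have E := congr1 (fun x => a · T # x) (gmulgV G).
rewrite /= !fmapM !compA !comp_Tmpair fmap1 compm1 in E.
rewrite /tmul E -[RHS]compA tz_nat !compA; congr (_ · _).
exact: (bang_uniq (T_one T)).
Qed.

Lemma tmul_addT (X : C) (a b a' b' : Hom X (T G))
    (Ha : a · tp T G = a' · tp T G) (Hb : b · tp T G = b' · tp T G)
    (H : tmul a b · tp T G = tmul a' b' · tp T G) :
  addT H = tmul (addT Ha) (addT Hb).
Proof.
have K : tpair a b · tp T (pro T G G) = tpair a' b' · tp T (pro T G G).
  by rewrite !tpair_p Ha Hb.
by rewrite /tmul -(tpair_addT Ha Hb K) (addT_nat _ H).
Qed.

(* The negation of the tangent bundle of a group: a tangent vector [v] at [g]
   is sent to the product [0_g . T(ginv)(v) . 0_g] in the group [T G]. By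
   [gneg_negation] and [negation_uniq], it is the negation. *)
Definition gneg : Hom (T G) (T G) :=
  tmul (tmul (tp T G · tz T G) (T # ginv G)) (tp T G · tz T G).

Lemma gneg_p : gneg · tp T G = tp T G.
Proof.
rewrite /gneg !tmul_p -!compA !tzp !compm1 tp_nat.
have -> : ⟨tp T G, tp T G · ginv G⟩ · gmul G
    = to_one T (T G) · gunit G by apply: gmulgVe.
by rewrite gmul1e.
Qed.

Lemma gneg_negation : is_negation gneg.
Proof.
exists gneg_p.
set H := etrans _ _.
set v := idm (T G).
set o := tp T G · tz T G; set w := T # ginv G.
set o' := w · tp T G · tz T G.
have ov : o · tp T G = v · tp T G by rewrite /o /v -compA tzp compm1 comp1m.
have o'w : o' · tp T G = w · tp T G by rewrite /o' -compA tzp compm1.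
have oo' : tmul o o' = to_one T (T G) · gunit G · tz T G.
  rewrite /o /o' -gmul_z tp_nat; congr (_ · _); exact: gmulgVe.
have o'o : tmul o' o = to_one T (T G) · gunit G · tz T G.
  rewrite /o /o' -gmul_z tp_nat; congr (_ · _); exact: gmulVge.
have ev : v = tmul (tmul v o') o by rewrite tmulA o'o tmulz1.
have K1 : tmul v o' · tp T G = tmul o w · tp T G.
  by rewrite !tmul_p ov o'w.
have K2 : tmul (tmul v o') o · tp T G = tmul (tmul o w) o · tp T G.
  by rewrite !(tmul_p _ o) K1.
have -> : addT H = addT K2 by apply: addT_congr.
rewrite (tmul_addT K1 erefl K2) (tmul_addT (esym ov) o'w K1).
rewrite (addT0 (esym ov)); last by rewrite /v comp1m.
rewrite (addTC o'w (esym o'w)) (addT0 (esym o'w)) //.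
rewrite addT0; last by rewrite ov /v comp1m.
have -> : tmul v w = tmul v (v · w) by rewrite /v comp1m.
by rewrite tmulV tmul1z.
Qed.

End GroupTangent.

Section PLIVF.
Context (C : category) (T : cartesian_tangent C) (G : group_object T).

Local Notation pi1 := (@pi1 C T _ _).
Local Notation pi2 := (@pi2 C T _ _).

(* [m_G x id_A], with [(G x G) x A] identified with [G x (G x A)]. *)
Definition gmul_id (A : C) : Hom (pro T G (pro T G A)) (pro T G A) :=
  ⟨⟨pi1, pi2 · pi1⟩ · gmul G, pi2 · pi2⟩.

Record plivf (A : C) := Plivf {
  plv :> Hom (pro T G A) (T G);
  plv_p : plv · tp T G = pi1;
  plv_inv : gmul_id A · plv = tmul (pi1 · tz T G) (pi2 · plv) }.

Lemma plivf_eq (A : C) (X Y : plivf A) : X = Y :> Hom _ _ -> X = Y.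
Proof.
case: X Y => [X pX iX] [Y pY iY] /= E; case: Y / E pY iY => pY iY.
by rewrite (proof_irrelevance _ pX pY) (proof_irrelevance _ iX iY).
Qed.

Lemma gmul_id1 (A : C) : gmul_id A · pi1 = ⟨pi1, pi2 · pi1⟩ · gmul G.
Proof. exact: mpair1. Qed.

Lemma gmul_id2 (A : C) : gmul_id A · pi2 = pi2 · pi2.
Proof. exact: mpair2. Qed.

(* The contravariant functor [g(-)] on morphisms. *)
Definition id_pro (A B : C) (f : Hom A B) : Hom (pro T G A) (pro T G B) :=
  ⟨pi1, pi2 · f⟩.

Lemma plivf_map_p (A B : C) (f : Hom A B) (X : plivf B) :
  id_pro f · X · tp T G = pi1.
Proof. by rewrite -compA plv_p mpair1. Qed.

Lemma plivf_map_inv (A B : C) (f : Hom A B) (X : plivf B) :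
  gmul_id A · (id_pro f · X) = tmul (pi1 · tz T G) (pi2 · (id_pro f · X)).
Proof.
have -> : gmul_id A · (id_pro f · X)
    = (⟨pi1, pi2 · id_pro f⟩ : Hom _ (pro T G (pro T G B))) · (gmul_id B · X).
  rewrite !compA; congr (_ · _); apply: pro_ext.
    rewrite /id_pro -!compA mpair1 !gmul_id1 compA comp_mpair mpair1.
    by rewrite (compA ⟨_, _⟩) mpair2 -compA mpair1.
  rewrite /id_pro -!compA mpair2 (compA _ pi2) !gmul_id2.
  by rewrite (compA ⟨_, _⟩) mpair2 -!compA mpair2.
by rewrite plv_inv comp_tmul !compA mpair1 mpair2.
Qed.

Definition plivf_map (A B : C) (f : Hom A B) (X : plivf B) : plivf A :=
  Plivf (plivf_map_p f X) (plivf_map_inv f X).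

Lemma plivf0_p (A : C) : pi1 · tz T G · tp T G = pi1 :> Hom (pro T G A) G.
Proof. by rewrite -compA tzp compm1. Qed.

Lemma plivf0_inv (A : C) :
  gmul_id A · (pi1 · tz T G) = tmul (pi1 · tz T G) (pi2 · (pi1 · tz T G)).
Proof. by rewrite !compA gmul_id1 gmul_z. Qed.

Definition plivf0 (A : C) : plivf A := Plivf (@plivf0_p A) (@plivf0_inv A).

Lemma plivf_pp (A : C) (X Y : plivf A) : X · tp T G = Y · tp T G.
Proof. by rewrite !plv_p. Qed.

Lemma plivfD_p (A : C) (X Y : plivf A) :
  addT (plivf_pp X Y) · tp T G = pi1.
Proof. by rewrite addT_p plv_p. Qed.

Lemma plivfD_inv (A : C) (X Y : plivf A) :
  gmul_id A · addT (plivf_pp X Y)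
  = tmul (pi1 · tz T G) (pi2 · addT (plivf_pp X Y)).
Proof.
have H1 : gmul_id A · X · tp T G = gmul_id A · Y · tp T G.
  by rewrite -!compA !plv_p.
have H2 : pi2 · X · tp T G = pi2 · Y · tp T G :> Hom (pro T G (pro T G A)) _.
  by rewrite -!compA !plv_p.
rewrite (comp_addT _ H1) (comp_addT _ H2).
have H3 : tmul (pi1 · tz T G) (pi2 · X) · tp T G
    = tmul (pi1 · tz T G) (pi2 · Y) · tp T G by rewrite -(plv_inv X) -(plv_inv Y).
rewrite (addT_congr H1 H3 (plv_inv X) (plv_inv Y)).
rewrite (tmul_addT erefl H2 H3) [addT (erefl _)]addT0 //.
by rewrite -[in RHS](compA pi1) tzp compm1.
Qed.

Definition plivfD (A : C) (X Y : plivf A) : plivf A :=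
  Plivf (plivfD_p X Y) (plivfD_inv X Y).

(* [<X, pi2 z_A> T Y] *)
Definition bracket_term (A : C) (X Y : plivf A) :
    Hom (pro T G A) (T (T G)) :=
  tpair X (pi2 · tz T A) · T # Y.

Lemma bracket_term_p (A : C) (X Y : plivf A) :
  bracket_term X Y · tp T (T G) = Y.
Proof.
rewrite /bracket_term -compA tp_nat compA tpair_p -compA tzp compm1 plv_p.
by rewrite [X in X · _](_ : _ = idm _) ?comp1m //;
  apply: pro_ext; rewrite ?mpair1 ?mpair2 comp1m.
Qed.

Lemma bracket_term_Tp (A : C) (X Y : plivf A) :
  bracket_term X Y · T # tp T G = X.
Proof. by rewrite /bracket_term -compA -fmapM plv_p tpair1. Qed.

Lemma bracket_term_pp (A : C) (X Y : plivf A) :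
  bracket_term X Y · tp T (T G) = bracket_term Y X · tc T G · tp T (T G).
Proof. by rewrite -compA tcp bracket_term_Tp bracket_term_p. Qed.

Definition bracket_diff (A : C) (X Y : plivf A) : Hom (pro T G A) (T (T G)) :=
  subTT (gneg_p G) (bracket_term_pp X Y).

Lemma bracket_diff_p (A : C) (X Y : plivf A) :
  bracket_diff X Y · tp T (T G) = Y.
Proof. by rewrite /bracket_diff /subTT addT_p bracket_term_p. Qed.

Lemma z_gneg : tz T G · gneg G = tz T G.
Proof.
have H2 : tz T G · tp T G = tz T G · gneg G · tp T G.
  by rewrite -compA gneg_p.
apply: (addT_inv_uniq (Hg := H2) (Hh := erefl)).
  exact: addT_neg (gneg_negation G).
by rewrite addT0 tzp comp1m.
Qed.

Lemma bracket_diff_Tp (A : C) (X Y : plivf A) :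
  bracket_diff X Y · T # tp T G = pi1 · tz T G.
Proof.
rewrite /bracket_diff /subTT.
rewrite (addT_nat _ (addT_nat_comm (tp T G)
  (subTT_comm (gneg_p G) (bracket_term_pp X Y)))).
have H1 : X · tp T G = X · gneg G · tp T G by rewrite -compA gneg_p.
transitivity (addT H1).
  apply: addT_congr; first exact: bracket_term_Tp.
  rewrite -2!compA [X in _ · X]compA tc_negTT_Tp tp_nat.
  by rewrite compA bracket_term_p.
by rewrite (addT_neg H1 (gneg_negation G)) plv_p.
Qed.

Lemma bracket_diff_lift (A : C) (X Y : plivf A) :
  bracket_diff X Y · T # tp T G
  = bracket_diff X Y · tp T (T G) · tp T G · tz T G.
Proof. by rewrite bracket_diff_Tp bracket_diff_p plv_p. Qed.

(* [[X, Y] = {<X, pi2 z_A> T Y - <Y, pi2 z_A> T X c_G}] *)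
Definition bracket (A : C) (X Y : plivf A) : Hom (pro T G A) (T G) :=
  lift (bracket_diff_lift X Y).

Lemma bracket_p (A : C) (X Y : plivf A) : bracket X Y · tp T G = pi1.
Proof. by rewrite /bracket lift_p bracket_diff_p plv_p. Qed.

Lemma gneg_tmul (X : C) (a b : Hom X (T G)) :
  tmul a b · gneg G = tmul (a · gneg G) (b · gneg G).
Proof.
have K (v : Hom X (T G)) : v · tp T G = v · gneg G · tp T G.
  by rewrite -compA gneg_p.
have EK (v : Hom X (T G)) : addT (K v) = v · tp T G · tz T G.
  exact: addT_neg (gneg_negation G).
have K2 : tmul a b · tp T G = tmul (a · gneg G) (b · gneg G) · tp T G.
  by rewrite !tmul_p -!K.
apply: (addT_inv_uniq (Hg := K _) (Hh := K2)); first exact: EK.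
by rewrite (tmul_addT (K a) (K b) K2) !EK tmul_p gmul_z.
Qed.

Definition ttmul (X : C) (a b : Hom X (T (T G))) : Hom X (T (T G)) :=
  ttpair a b · T # T # gmul G.

Lemma Tgmul_gneg : T # gmul G · gneg G
  = tpair (T # pi1 · gneg G) (T # pi2 · gneg G) · T # gmul G.
Proof.
have E : tpair (T # pi1) (T # pi2) = idm (T (pro T G G)).
  by apply: tpro_ext; rewrite ?tpair1 ?tpair2 comp1m.
by rewrite -[LHS]comp1m -E compA (gneg_tmul (T # pi1) (T # pi2)).
Qed.

Lemma ttmul_neg (X : C) (a b : Hom X (T (T G))) :
  ttmul a b · negTT (gneg G) = ttmul (a · negTT (gneg G)) (b · negTT (gneg G)).
Proof.
rewrite /ttmul /negTT !compA -(compA (ttpair _ _)) tc_nat compA ttpair_c.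
rewrite -(compA _ (T # T # gmul G)) -fmapM Tgmul_gneg fmapM compA.
rewrite -(compA _ (T # T # gmul G)) tc_nat compA; congr (_ · _).
have -> (u v : Hom X (T (T G))) : ttpair u v
    · T # tpair (T # pi1 · gneg G) (T # pi2 · gneg G)
    = ttpair (u · T # gneg G) (v · T # gneg G).
  apply: ttpro_ext; rewrite ?ttpair1 ?ttpair2 -compA -fmapM ?tpair1 ?tpair2.
    by rewrite fmapM compA ttpair1.
  by rewrite fmapM compA ttpair2.
by rewrite ttpair_c.
Qed.

Lemma comp_ttmul (X Y : C) (h : Hom Y X) (a b : Hom X (T (T G))) :
  h · ttmul a b = ttmul (h · a) (h · b).
Proof.
rewrite /ttmul compA; congr (_ · _).
by apply: ttpro_ext; rewrite -compA ?ttpair1 ?ttpair2.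
Qed.

Lemma ttmul_p (X : C) (a b : Hom X (T (T G))) :
  ttmul a b · tp T (T G) = tmul (a · tp T (T G)) (b · tp T (T G)).
Proof. by rewrite /ttmul -compA tp_nat compA ttpair_p. Qed.

Lemma ttmul_addT (X : C) (a b a' b' : Hom X (T (T G)))
    (Ha : a · tp T (T G) = a' · tp T (T G))
    (Hb : b · tp T (T G) = b' · tp T (T G))
    (H : ttmul a b · tp T (T G) = ttmul a' b' · tp T (T G)) :
  addT H = ttmul (addT Ha) (addT Hb).
Proof.
have K : ttpair a b · tp T (T (pro T G G)) = ttpair a' b' · tp T _.
  by rewrite !ttpair_p Ha Hb.
by rewrite /ttmul -(ttpair_addT Ha Hb K) (addT_nat _ H).
Qed.

Lemma ttmul_addTT (X : C) (a b a' b' : Hom X (T (T G)))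
    (Ha : a · T # tp T G = a' · T # tp T G)
    (Hb : b · T # tp T G = b' · T # tp T G)
    (H : ttmul a b · T # tp T G = ttmul a' b' · T # tp T G) :
  addTT H = ttmul (addTT Ha) (addTT Hb).
Proof.
have K : ttpair a b · T # tp T (pro T G G) = ttpair a' b' · T # tp T _.
  have ttp (u v : Hom X (T (T G))) : ttpair u v · T # tp T (pro T G G)
      = tpair (u · T # tp T G) (v · T # tp T G).
    by apply: tpro_ext; rewrite ?tpair1 ?tpair2 -compA -fmapM -tp_nat fmapM
      compA ?ttpair1 ?ttpair2.
  by rewrite !ttp Ha Hb.
by rewrite /ttmul -(ttpair_addTT Ha Hb K) (addTT_nat _ H).
Qed.

Lemma bracket_term_inv (A : C) (X Y : plivf A) :
  gmul_id A · bracket_term X Y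
  = ttmul (pi1 · tz T G · T # tz T G) (pi2 · bracket_term X Y).
Proof.
set Z := pro T G (pro T G A).
set e : Hom Z (T Z) := tpair (pi1 · tz T G) (tpair (pi2 · X) (pi2 · pi2 · tz T A)).
have He : gmul_id A · tpair X (pi2 · tz T A) = e · T # gmul_id A.
  rewrite comp_tpair comp_Tmpair !fmapM !compA gmul_id2 plv_inv.
  by rewrite comp_Tmpair fmapM compA tpair1 tpair2 tpair1 tpair2.
rewrite /bracket_term compA He -compA -fmapM plv_inv /tmul fmapM compA.
rewrite /ttmul; congr (_ · _); apply: ttpro_ext; rewrite ?ttpair1 ?ttpair2.
  by rewrite -compA -fmapM tpair1 fmapM compA tpair1.
by rewrite -compA -fmapM tpair2 fmapM compA tpair2 compA comp_tpair compA.
Qed.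

Lemma zz_c : tz T G · T # tz T G · tc T G = tz T G · T # tz T G.
Proof. by rewrite -{1}tz_nat -!compA tzc. Qed.

Lemma zz_pz (X : C) (u : Hom X G) :
  u · tz T G · T # tz T G · tp T (T G) · tz T (T G) = u · tz T G · T # tz T G.
Proof.
rewrite -(compA u) -tz_nat -!compA (compA (tz T (T G)) (tp T (T G))) tzp comp1m.
by [].
Qed.

Lemma bracket_diff_inv (A : C) (X Y : plivf A) :
  gmul_id A · bracket_diff X Y
  = ttmul (pi1 · tz T G · T # tz T G) (pi2 · bracket_diff X Y).
Proof.
rewrite /bracket_diff /subTT.
set H := subTT_comm _ _.
have H1 : gmul_id A · bracket_term X Y · tp T (T G)
    = gmul_id A · (bracket_term Y X · tc T G · negTT (gneg G)) · tp T (T G).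
  by rewrite -2!(compA (gmul_id A)) H.
rewrite (comp_addT _ H1).
set a := _ · T # tz T G.
have ac : a · tc T G = a by rewrite /a -!compA (compA (tz T G)) zz_c.
have an : a · negTT (gneg G) = a.
  rewrite /negTT !compA ac -[X in X · _](_ : a = _) ?ac //.
  by rewrite /a -[RHS]compA -fmapM z_gneg.
have H2 : pi2 · bracket_term X Y · tp T (T G)
    = pi2 · (bracket_term Y X · tc T G · negTT (gneg G)) · tp T (T G)
    :> Hom (pro T G (pro T G A)) _.
  by rewrite -2!(compA pi2) H.
have E2 : gmul_id A · (bracket_term Y X · tc T G · negTT (gneg G))
    = ttmul a (pi2 · (bracket_term Y X · tc T G · negTT (gneg G))).
  rewrite 2!(compA (gmul_id A)) bracket_term_inv -/a 2!(compA pi2).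
  have -> (u v : Hom (pro T G (pro T G A)) (T (T G))) :
      ttmul u v · tc T G = ttmul (u · tc T G) (v · tc T G).
    by rewrite /ttmul -compA tc_nat compA ttpair_c.
  by rewrite ac ttmul_neg an.
have H3 : ttmul a (pi2 · bracket_term X Y) · tp T (T G)
    = ttmul a (pi2 · (bracket_term Y X · tc T G · negTT (gneg G)))
      · tp T (T G).
  by rewrite !ttmul_p H2.
rewrite (addT_congr H1 H3 (bracket_term_inv X Y) E2).
rewrite (ttmul_addT erefl H2 H3) (comp_addT _ H2).
rewrite [addT (erefl _)]addT0 //.
by rewrite /a zz_pz.
Qed.

Lemma bracket_inv (A : C) (X Y : plivf A) :
  gmul_id A · bracket X Y = tmul (pi1 · tz T G) (pi2 · bracket X Y).
Proof.
set D := bracket_diff X Y.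
have HD : gmul_id A · D · T # tp T G
    = gmul_id A · D · tp T (T G) · tp T G · tz T G.
  by rewrite -(compA (gmul_id A)) /D bracket_diff_lift !compA.
have K0 : D · tp T (T G) · tz T (T G) · T # tp T G
    = bracket X Y · tl T G · T # tp T G.
  by apply: xi_Tp; rewrite /D bracket_diff_p plv_p bracket_p.
have E0 : addTT K0 = D by apply: lift_spec.
have -> : gmul_id A · bracket X Y = lift HD.
  have K1 : gmul_id A · D · tp T (T G) · tz T (T G) · T # tp T G
      = gmul_id A · bracket X Y · tl T G · T # tp T G.
    by rewrite -!(compA (gmul_id A)) K0.
  apply: (@lift_uniq _ _ _ _ _ HD _ K1).
  rewrite -[in RHS]E0.
  have K2 : gmul_id A · (D · tp T (T G) · tz T (T G)) · T # tp T G
      = gmul_id A · (bracket X Y · tl T G) · T # tp T G.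
    by rewrite -!(compA (gmul_id A)) K0.
  rewrite (comp_addTT _ K2); apply: addTT_congr; last by rewrite compA.
  by rewrite -!(compA (gmul_id A)).
apply/esym.
have K1 : gmul_id A · D · tp T (T G) · tz T (T G) · T # tp T G
    = tmul (pi1 · tz T G) (pi2 · bracket X Y) · tl T G · T # tp T G.
  apply: xi_Tp; rewrite -(compA (gmul_id A) D) /D bracket_diff_p.
  rewrite -(compA (gmul_id A) Y) plv_p gmul_id1 tmul_p.
  by rewrite -(compA pi1) tzp compm1 -(compA pi2) bracket_p.
apply: (@lift_uniq _ _ _ _ _ HD _ K1).
pose a : Hom (pro T G (pro T G A)) _ := pi1 · tz T G · T # tz T G.
have ap : a · tp T (T G) · tz T (T G) = a.
  exact: zz_pz.
have Ka : a · T # tp T G = a · T # tp T G by [].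
have Kb : pi2 · (D · tp T (T G) · tz T (T G)) · T # tp T G
    = pi2 · (bracket X Y · tl T G) · T # tp T G
    :> Hom (pro T G (pro T G A)) _.
  by rewrite -!(compA pi2) K0.
have e1 : gmul_id A · D · tp T (T G) · tz T (T G)
    = ttmul a (pi2 · (D · tp T (T G) · tz T (T G))).
  rewrite /D bracket_diff_inv -/a ttmul_p /ttmul -[LHS]compA tz_nat compA.
  by rewrite tpair_zT ap !compA.
have e2 : tmul (pi1 · tz T G) (pi2 · bracket X Y) · tl T G
    = ttmul a (pi2 · (bracket X Y · tl T G)).
  rewrite /tmul /ttmul -compA tl_nat compA tpair_l; congr (ttpair _ _ · _).
    by rewrite -compA tzl compA.
  by rewrite compA.
have K3 : ttmul a (pi2 · (D · tp T (T G) · tz T (T G))) · T # tp T G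
    = ttmul a (pi2 · (bracket X Y · tl T G)) · T # tp T G.
  by rewrite -e1 -e2.
rewrite (addTT_congr K1 K3 e1 e2) (ttmul_addTT Ka Kb K3).
rewrite -(comp_addTT K0 Kb) E0 /D bracket_diff_inv -/a.
congr (ttmul _ _); apply: addTT0.
by rewrite /a -!compA -!fmapM (compA _ (tp T G)) tzp comp1m.
Qed.

Definition plivf_bracket (A : C) (X Y : plivf A) : plivf A :=
  Plivf (bracket_p X Y) (bracket_inv X Y).

(* A representation of the Lie functor: an object with a natural isomorphism
   [phi_A] from [g(A)] to [Hom A g]. *)
Record lie_representation := LieRepresentation {
  lie_obj : C;
  lie_phi : forall A, plivf A -> Hom A lie_obj;
  lie_phi_inv : forall A, Hom A lie_obj -> plivf A;
  lie_phiK : forall A, cancel (@lie_phi A) (@lie_phi_inv A);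
  lie_phi_invK : forall A, cancel (@lie_phi_inv A) (@lie_phi A);
  lie_phi_nat : forall A B (f : Hom A B) (X : plivf B),
    lie_phi (plivf_map f X) = f · lie_phi X }.

Arguments lie_phi R {A} _ : rename.
Arguments lie_phi_inv R {A} _ : rename.

Section Representation.
Context (R : lie_representation).
Let g := lie_obj R.

Definition lie_omega : plivf g := lie_phi_inv R (idm g).

Lemma lie_phi_omega (A : C) (X : plivf A) :
  plivf_map (lie_phi R X) lie_omega = X.
Proof.
by rewrite -[LHS](lie_phiK R) lie_phi_nat lie_phi_invK compm1 lie_phiK.
Qed.

Lemma lie_phi_uniq (A : C) (f : Hom A g) (X : plivf A) :
  plivf_map f lie_omega = X -> f = lie_phi R X.
Proof. by move=> <-; rewrite lie_phi_nat lie_phi_invK compm1. Qed.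

(* By [lie_phi_omega] and [lie_phi_uniq], the operations below are the unique
   [f] such that [plivf_map f lie_omega] is the given PLIVF. *)
Definition lie_omega1 : plivf (pro T g g) := plivf_map pi1 lie_omega.
Definition lie_omega2 : plivf (pro T g g) := plivf_map pi2 lie_omega.

Definition lie_zero : Hom (one T) g := lie_phi R (plivf0 (one T)).
Definition lie_add : Hom (pro T g g) g :=
  lie_phi R (plivfD lie_omega1 lie_omega2).
Definition lie_bracket : Hom (pro T g g) g :=
  lie_phi R (plivf_bracket lie_omega1 lie_omega2).

End Representation.
End PLIVF.

Section LieGroup.
Context (C : category) (T : cartesian_tangent C) (G : lie_group T).

Local Notation pi1 := (@pi1 C T _ _).
Local Notation pi2 := (@pi2 C T _ _).

Definition TeG_pb : is_pullback (tp T G) (gunit G) (TeG_incl G)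
    (to_one T (TeG G)) := TeG_lim G 0.

(* [omega = (z_G x TeG_incl) T m_G] *)
Definition Te_omega : Hom (pro T G (TeG G)) (T G) :=
  tmul (pi1 · tz T G) (pi2 · TeG_incl G).

Lemma Te_omega_p : Te_omega · tp T G = pi1.
Proof.
rewrite /Te_omega tmul_p -!compA tzp compm1 (pb_comm TeG_pb) compA.
exact: gmule1.
Qed.

Lemma Te_omega_inv :
  gmul_id G (TeG G) · Te_omega = tmul (pi1 · tz T G) (pi2 · Te_omega).
Proof.
rewrite /Te_omega !comp_tmul !compA gmul_id1 gmul_id2 gmul_z tmulA.
by [].
Qed.

Definition Te_omega_plivf : plivf G (TeG G) := Plivf Te_omega_p Te_omega_inv.

Definition at_unit (A : C) : Hom A (pro T G A) :=
  ⟨to_one T A · gunit G, idm A⟩.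

Lemma Te_phi_comm (A : C) (X : plivf G A) :
  at_unit A · X · tp T G = to_one T A · gunit G.
Proof. by rewrite -compA plv_p mpair1. Qed.

Definition Te_phi (A : C) (X : plivf G A) : Hom A (TeG G) :=
  pb_med TeG_pb (Te_phi_comm X).

Lemma Te_phi_incl (A : C) (X : plivf G A) :
  Te_phi X · TeG_incl G = at_unit A · X.
Proof. exact: (pb_med1 TeG_pb). Qed.

Lemma Te_phiK (A : C) :
  cancel (@Te_phi A) (fun f => plivf_map f Te_omega_plivf).
Proof.
move=> X; apply: plivf_eq; rewrite /= /Te_omega comp_tmul.
rewrite !compA mpair1 mpair2 -(compA pi2) Te_phi_incl.
pose h : Hom (pro T G A) (pro T G (pro T G A)) := ⟨pi1, pi2 · at_unit A⟩.
have E := congr1 (fun x => h · x) (plv_inv X).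
rewrite /= comp_tmul !compA mpair1 mpair2 in E.
rewrite !compA -E -[RHS]comp1m; congr (_ · _).
apply: pro_ext; rewrite comp1m -compA.
  rewrite gmul_id1 compA comp_mpair mpair1 compA mpair2 -compA mpair1 compA.
  exact: gmule1.
by rewrite gmul_id2 compA mpair2 -compA mpair2 compm1.
Qed.

Lemma Te_phi_invK (A : C) :
  cancel (fun f : Hom A _ => plivf_map f Te_omega_plivf) (@Te_phi A).
Proof.
move=> f; apply: (pb_uniq TeG_pb); last exact: to_one_uniq.
rewrite Te_phi_incl /= /Te_omega !comp_tmul.
have -> : at_unit A · (id_pro G f · (pi1 · tz T G))
    = to_one T A · gunit G · tz T G.
  by rewrite (compA (id_pro G f)) mpair1 compA mpair1.
have -> : at_unit A · (id_pro G f · (pi2 · TeG_incl G)) = f · TeG_incl G.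
  by rewrite (compA (id_pro G f)) mpair2 2!compA mpair2 comp1m.
exact: tmul1z.
Qed.

Lemma Te_phi_nat (A B : C) (f : Hom A B) (X : plivf G B) :
  Te_phi (plivf_map f X) = f · Te_phi X.
Proof.
apply: (pb_uniq TeG_pb); last exact: to_one_uniq.
rewrite -compA !Te_phi_incl /= !compA; congr (_ · _).
apply: pro_ext; rewrite -!compA ?mpair1 ?mpair2.
  rewrite compA; congr (_ · _); exact: to_one_uniq.
by rewrite compA mpair2 comp1m compm1.
Qed.

Definition Te_representation : lie_representation G :=
  LieRepresentation Te_phiK Te_phi_invK Te_phi_nat.

Lemma Te_representation_omega : lie_omega Te_representation = Te_omega_plivf.
Proof.
apply: plivf_eq; rewrite /= -[RHS]comp1m; congr (_ · _).
by apply: pro_ext; rewrite ?mpair1 ?mpair2 comp1m ?compm1.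
Qed.

End LieGroup.

(* Main.v *)
From mathcomp Require Import all_boot.
Require Import Defs.

(* The objects [T^n G] are groups, and [p], [z], [l], [c] are group morphisms
   between them. A PLIVF is determined by its value at the unit, an element of
   the kernel of [p : T G -> G]. On the kernel of [p] fibrewise addition agrees
   with the multiplication (Eckmann-Hilton); in particular this kernel is
   abelian. Unfolding the bracket of two PLIVFs with values [x] and [y] gives a
   value [u] with [u l = (x T z) (y z) (x T z)^-1 (y z)^-1] in [T (T G)]: the Lie
   bracket is a group commutator of two elements placed in different tangent
   directions. Additivity and antisymmetry are then commutator identities, and
   the Jacobi identity is the Hall-Witt identity in [T (T (T G))] for three
   elements in the three directions. *)

Set Implicit Arguments.
Unset Strict Implicit.
Unset Printing Implicit Defensive.

(** * Group and commutator identities for generalized elements *)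

Section Elements.
Context (C : category) (T : cartesian_tangent C) (H : group_object T).

Definition emul (X : C) (a b : Hom X H) : Hom X H := ⟨a, b⟩ · gmul H.
Definition eunit (X : C) : Hom X H := to_one T X · gunit H.
Definition einv (X : C) (a : Hom X H) : Hom X H := a · ginv H.
Definition ecomm (X : C) (a b : Hom X H) : Hom X H :=
  emul (emul a b) (emul (einv a) (einv b)).

Lemma comp_emul (X Y : C) (h : Hom Y X) (a b : Hom X H) :
  h · emul a b = emul (h · a) (h · b).
Proof. by rewrite /emul compA comp_mpair. Qed.

Lemma comp_eunit (X Y : C) (h : Hom Y X) : h · eunit X = eunit Y.
Proof. by rewrite /eunit compA; congr (_ · _); apply: to_one_uniq. Qed.

Lemma comp_einv (X Y : C) (h : Hom Y X) (a : Hom X H) :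
  h · einv a = einv (h · a).
Proof. exact: compA. Qed.

Lemma comp_ecomm (X Y : C) (h : Hom Y X) (a b : Hom X H) :
  h · ecomm a b = ecomm (h · a) (h · b).
Proof. by rewrite /ecomm !comp_emul !comp_einv. Qed.

Lemma emulA (X : C) (a b c : Hom X H) :
  emul a (emul b c) = emul (emul a b) c.
Proof. exact/esym/gmulAe. Qed.

Lemma emul1 (X : C) (a : Hom X H) : emul (eunit X) a = a.
Proof. exact: gmul1e. Qed.

Lemma emule (X : C) (a : Hom X H) : emul a (eunit X) = a.
Proof. exact: gmule1. Qed.

Lemma emulV (X : C) (a : Hom X H) : emul (einv a) a = eunit X.
Proof. exact: gmulVge. Qed.

Lemma emulVr (X : C) (a : Hom X H) : emul a (einv a) = eunit X.
Proof. exact: gmulgVe. Qed.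

Lemma emulK (X : C) (a b : Hom X H) : emul (emul b a) (einv a) = b.
Proof. by rewrite -emulA emulVr emule. Qed.

Lemma emulVK (X : C) (a b : Hom X H) : emul (emul b (einv a)) a = b.
Proof. by rewrite -emulA emulV emule. Qed.

Lemma emulI (X : C) (a : Hom X H) : injective (fun b => emul b a).
Proof. by move=> b c /(congr1 (fun d => emul d (einv a))); rewrite !emulK. Qed.

Lemma einv_eq (X : C) (a b : Hom X H) : emul a b = eunit X -> a = einv b.
Proof. by move=> ab; apply: (@emulI _ b); rewrite emulV. Qed.

Lemma einvM (X : C) (a b : Hom X H) :
  einv (emul a b) = emul (einv b) (einv a).
Proof. by apply/esym/einv_eq; rewrite emulA emulVK emulV. Qed.

Lemma einvK (X : C) (a : Hom X H) : einv (einv a) = a.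
Proof. by apply/esym/einv_eq; rewrite emulVr. Qed.

Lemma einv1 (X : C) : einv (eunit X) = eunit X.
Proof. by apply/esym/einv_eq; rewrite emul1. Qed.

Lemma ecomm_inv (X : C) (a b : Hom X H) : einv (ecomm a b) = ecomm b a.
Proof. by rewrite /ecomm !einvM !einvK. Qed.

Lemma ecomm1 (X : C) (a : Hom X H) : ecomm (eunit X) a = eunit X.
Proof. by rewrite /ecomm einv1 !emul1 emulVr. Qed.

Lemma ecomm_mull (X : C) (a b c : Hom X H) :
  ecomm (emul a b) c = emul (emul a (emul (ecomm b c) (einv a))) (ecomm a c).
Proof. by rewrite /ecomm einvM !emulA !emulVK. Qed.

(** Since [b] commutes with [u], the left side is the conjugate of [ecomm u c] by [b]; and [b]
    commutes with that commutator too. *)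
Lemma ecomm_conj (X : C) (u b c : Hom X H) :
  emul u b = emul b u -> emul (ecomm u c) b = emul b (ecomm u c) ->
  ecomm u (emul (emul b c) (einv b)) = ecomm u c.
Proof.
move=> ub tb; apply: (@emulI _ b); rewrite tb /ecomm.
have ub' x : emul (emul (emul x (einv b)) (einv u)) b = emul x (einv u).
  by apply: (@emulI _ u); rewrite emulVK -emulA -ub emulA emulVK emulVK.
by rewrite !einvM einvK !emulA emulVK ub ub'.
Qed.

(** In this form every conjugation sits on the second entry of an outer commutator, where
    [ecomm_conj] can remove it. *)
Lemma Hall_Witt (X : C) (a b c : Hom X H) :
  emul (emul (ecomm (ecomm a b) (emul (emul b c) (einv b)))
             (ecomm (ecomm b c) (emul (emul c a) (einv c))))
       (ecomm (ecomm c a) (emul (emul a b) (einv a))) = eunit X.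
Proof. by rewrite /ecomm !einvM !einvK !emulA !(emulK, emulVK) emulVr. Qed.

End Elements.

(** * Homomorphisms of group objects *)

Section Homs.
Context (C : category) (T : cartesian_tangent C).

Definition is_ghom (H H' : group_object T) (f : Hom H H') : Prop :=
  forall X (a b : Hom X H), emul a b · f = emul (a · f) (b · f).

Context (H H' : group_object T) (f : Hom H H') (Hf : is_ghom f).

Lemma ghom1 (X : C) : eunit H X · f = eunit H' X.
Proof. by apply: (@emulI _ _ H' _ (eunit H X · f)); rewrite -Hf !emul1. Qed.

Lemma ghomV (X : C) (a : Hom X H) : einv a · f = einv (a · f).
Proof. by apply: einv_eq; rewrite -Hf emulV ghom1. Qed.

Lemma ghom_comm (X : C) (a b : Hom X H) :
  ecomm a b · f = ecomm (a · f) (b · f).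
Proof. by rewrite /ecomm !Hf !ghomV. Qed.

End Homs.

(** * The tangent object of a group as a group object *)

Section TangentGroup.
Context (C : category) (T : cartesian_tangent C).

Local Notation pi1 := (@pi1 C T _ _).
Local Notation pi2 := (@pi2 C T _ _).

Section TangentGroupObject.
Variable H : group_object T.

Definition tgmul : Hom (pro T (T H) (T H)) (T H) :=
  tpair pi1 pi2 · T # gmul H.
Definition tgunit : Hom (one T) (T H) := gunit H · tz T H.

Lemma mpair_tgmul (X : C) (a b : Hom X (T H)) : ⟨a, b⟩ · tgmul = tmul a b.
Proof. by rewrite compA comp_tpair mpair1 mpair2. Qed.

Lemma tgmulA : ⟨pi1, pi2 · tgmul⟩ · tgmul
  = ⟨⟨pi1, pi2 · pi1⟩ · tgmul, pi2 · pi2⟩ · tgmul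
  :> Hom (pro T (T H) (pro T (T H) (T H))) (T H).
Proof.
rewrite !mpair_tgmul tmulA; congr (tmul _ _).
by rewrite compA comp_tpair.
Qed.

Lemma tgmul1g : ⟨to_one T (T H) · tgunit, idm (T H)⟩ · tgmul = idm (T H).
Proof. by rewrite mpair_tgmul compA tmul1z. Qed.

Lemma tgmulg1 : ⟨idm (T H), to_one T (T H) · tgunit⟩ · tgmul = idm (T H).
Proof. by rewrite mpair_tgmul compA tmulz1. Qed.

Lemma tgmulgV :
  ⟨idm (T H), T # ginv H⟩ · tgmul = to_one T (T H) · tgunit.
Proof. by rewrite mpair_tgmul compA -(tmulV (idm (T H))) comp1m. Qed.

Lemma tgmulVg :
  ⟨T # ginv H, idm (T H)⟩ · tgmul = to_one T (T H) · tgunit.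
Proof.
have V1 : tmul (idm (T H)) (T # ginv H) = to_one T (T H) · gunit H · tz T H.
  by rewrite -(tmulV (idm (T H))) comp1m.
(* Multiply on the right by the inverse times its own right inverse. *)
rewrite mpair_tgmul compA -[LHS](tmulz1 _ (to_one T _)) -(tmulV (T # ginv H)).
by rewrite tmulA -(tmulA (idm _)) V1 tmul1z tmulV.
Qed.

Definition tgroup : group_object T :=
  GroupObject tgmulA tgmul1g tgmulg1 tgmulVg tgmulgV.

End TangentGroupObject.
Canonical tgroup.

Context (H : group_object T).

Lemma temulE (X : C) (a b : Hom X (T H)) :
  emul (H := tgroup H) a b = tmul a b.
Proof. exact: mpair_tgmul. Qed.

Lemma teunitE (X : C) : eunit (tgroup H) X = eunit H X · tz T H.
Proof. by rewrite /eunit compA. Qed.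

End TangentGroup.

(** * The tangent structure maps as group homomorphisms *)

Section TangentHoms.
Context (C : category) (T : cartesian_tangent C).

Lemma ttemulE (H : group_object T) (X : C) (a b : Hom X (T (T H))) :
  emul (H := tgroup (tgroup H)) a b = ttmul a b.
Proof.
rewrite temulE /tmul /= fmapM compA.
by rewrite /ttmul /ttpair.
Qed.

Context (H : group_object T).

Lemma comp_Temul (X Y : C) (h : Hom X (T Y)) (a b : Hom Y H) :
  h · T # emul a b = emul (H := tgroup H) (h · T # a) (h · T # b).
Proof. by rewrite temulE /emul fmapM compA comp_Tmpair. Qed.

Lemma tp_ghom : is_ghom (H := tgroup H) (tp T H).
Proof. by move=> X a b; rewrite temulE tmul_p. Qed.

Lemma tz_ghom : is_ghom (H' := tgroup H) (tz T H).
Proof. by move=> X a b; rewrite temulE -gmul_z. Qed.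

Lemma tl_ghom : is_ghom (H := tgroup H) (H' := tgroup (tgroup H)) (tl T H).
Proof.
by move=> X a b; rewrite ttemulE temulE /tmul -compA tl_nat compA tpair_l.
Qed.

Lemma tc_ghom :
  is_ghom (H := tgroup (tgroup H)) (H' := tgroup (tgroup H)) (tc T H).
Proof.
by move=> X a b; rewrite !ttemulE /ttmul -compA tc_nat compA ttpair_c.
Qed.

End TangentHoms.

(** * Fibrewise addition and the kernel of [p] *)

Section KernelComm.
Context (C : category) (T : cartesian_tangent C).

Lemma T_ghom (H H' : group_object T) (f : Hom H H') :
  is_ghom f -> is_ghom (H := tgroup H) (H' := tgroup H') (T # f).
Proof.
move=> Hf X a b; rewrite temulE.
(* The hypothesis on [f] is used for the universal pair of elements, the two projections, and [T] is
   applied to that instance. *)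
have E : gmul H = emul pi1 pi2.
  rewrite /emul -[LHS]comp1m; congr (_ · _).
  by apply: pro_ext; rewrite ?mpair1 ?mpair2 comp1m.
rewrite /tmul E -compA -fmapM Hf comp_Temul !fmapM !compA.
by rewrite tpair1 tpair2.
Qed.

Context (H : group_object T).

(* Fibrewise addition is a morphism of groups, so by the Eckmann-Hilton
   argument it agrees with the multiplication on the kernel of [p]. *)
Lemma addT_emul (X : C) (a b : Hom X (T H)) (E : a · tp T H = b · tp T H) :
  addT E = emul (H := tgroup H) a
             (emul (einv (a · tp T H · tz T H)) b).
Proof.
set h := a · tp T H · tz T H.
set k := emul (einv h) b.
have hp : h · tp T H = a · tp T H by rewrite -compA tzp compm1.
(* Interchange applied to [a = a * 1] and [b = h * k] gives [(a + h) * (1 + k)]; here [h] is the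
   zero vector under [a] and [1] the zero vector at the unit. *)
have eb : b = tmul h k by rewrite -temulE emulA emulVr emul1.
have ea : a = tmul a (eunit (tgroup H) X) by rewrite -temulE emule.
have Ka : a · tp T H = h · tp T H by [].
have kp : k · tp T H = eunit H X.
  by rewrite /k tp_ghom (ghomV (@tp_ghom _ _ H)) hp E emulV.
have Kb : eunit (tgroup H) X · tp T H = k · tp T H.
  by rewrite (ghom1 (@tp_ghom _ _ H)).
have K : tmul a (eunit (tgroup H) X) · tp T H = tmul h k · tp T H.
  by rewrite -ea -eb.
rewrite (addT_congr E K ea eb) (tmul_addT Ka Kb K) addT0 // temulE.
rewrite (addTC Kb (esym Kb)) addT0 // kp; exact: teunitE.
Qed.

Lemma kerp_comm (X : C) (a b : Hom X (T H)) :
  a · tp T H = eunit H X -> b · tp T H = eunit H X ->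
  emul (H := tgroup H) a b = emul (H := tgroup H) b a.
Proof.
move=> a0 b0; have E : a · tp T H = b · tp T H by rewrite b0.
have := addTC E (esym E).
by rewrite !addT_emul a0 b0 -teunitE einv1 !emul1.
Qed.

End KernelComm.

(** * The kernel of [T # p] and injectivity of the vertical lift *)

Section Directions.
Context (C : category) (T : cartesian_tangent C) (H : group_object T).

Lemma Tzc : T # tz T H · tc T H = tz T (T H).
Proof. by rewrite -tzc -compA tcK compm1. Qed.

(** The monoid laws are given for [p] only. Commutativity for the universal pair of projections of
    [T_2 H] is carried over by [T]. *)
Lemma addTTC (X : C) (a b : Hom X (T (T H)))
    (E : a · T # tp T H = b · T # tp T H)
    (E' : b · T # tp T H = a · T # tp T H) : addTT E = addTT E'.
Proof.
pose pr := tpowpr T 2 H.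
have L : pr ord_max · tp T H = pr ord0 · tp T H.
  by rewrite !(fp_comm (T2_lim T H)).
rewrite /addTT; have -> : fpair (TT2_lim T H) E
    = fpair (TT2_lim T H) E' · T # fpair (T2_lim T H) L.
  by apply: (fpow2_ext (TT2_lim T H)); rewrite -compA -fmapM ?fpair1 ?fpair2
    ?(fpair1 (TT2_lim T H)) ?(fpair2 (TT2_lim T H)).
rewrite -compA -fmapM -[_ · ts T H]/(addT L) (addTC L (esym L)).
congr (_ · T # _); rewrite /addT -[RHS]comp1m; congr (_ · _).
by apply: (fpow2_ext (T2_lim T H)); rewrite ?fpair1 ?fpair2 comp1m.
Qed.

(** The flip [tc] is an involutive homomorphism exchanging [T # tp T H] and [tp T (T H)], so
    [kerp_comm] transfers. *)
Lemma kerTp_comm (X : C) (a b : Hom X (T (T H))) :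
  a · T # tp T H = eunit (tgroup H) X ->
  b · T # tp T H = eunit (tgroup H) X ->
  emul (H := tgroup (tgroup H)) a b = emul (H := tgroup (tgroup H)) b a.
Proof.
move=> a0 b0.
have cK (u : Hom X (T (T H))) : u · tc T H · tc T H = u.
  by rewrite -compA tcK compm1.
rewrite -[LHS]cK -[RHS]cK (tc_ghom a b) (tc_ghom b a); congr (_ · _).
by apply: (@kerp_comm _ _ (tgroup H)); rewrite -compA tcp.
Qed.

(** Eckmann-Hilton in the other direction: interchange for [a = a * 1] and [b = 1 * b], where [1] is
    the zero vector for [T # p]. *)
Lemma addTT_emul (X : C) (a b : Hom X (T (T H)))
    (E : a · T # tp T H = b · T # tp T H) :
  a · T # tp T H = eunit (tgroup H) X ->
  addTT E = emul (H := tgroup (tgroup H)) a b.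
Proof.
move=> a0; pose e := eunit (tgroup (tgroup H)) X.
have e0 : e · T # tp T H = eunit (tgroup H) X.
  by rewrite (ghom1 (T_ghom (@tp_ghom _ _ H))).
have ez : e = e · T # tp T H · T # tz T H.
  by rewrite e0 (ghom1 (T_ghom (@tz_ghom _ _ H))).
have ea : a = ttmul a e by rewrite -ttemulE emule.
have eb : b = ttmul e b by rewrite -ttemulE emul1.
have Ka : a · T # tp T H = e · T # tp T H by rewrite e0.
have Kb : e · T # tp T H = b · T # tp T H by rewrite -Ka.
have K : ttmul a e · T # tp T H = ttmul e b · T # tp T H by rewrite -ea -eb.
rewrite (addTT_congr E K ea eb) (ttmul_addTT Ka Kb K) addTT0; last first.
  by rewrite Ka.
rewrite (addTTC Kb (esym Kb)) addTT0 ?ttemulE //.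
by rewrite -Kb.
Qed.

(** The composite [tl], [T # tp], [tp] is [tp], so [a] and [b] have the same base point; both then
    satisfy the property that determines [lift] of [a · tl T H]. *)
Lemma tl_inj (X : C) (a b : Hom X (T H)) :
  a · tl T H = b · tl T H -> a = b.
Proof.
move=> ab; have ppE (u : Hom X (T H)) :
    u · tl T H · T # tp T H · tp T H = u · tp T H.
  by rewrite -2!compA (compA _ (T # tp T H)) tlTp -(compA (tp T H)) tzp compm1.
have pab : a · tp T H = b · tp T H by rewrite -(ppE a) ab ppE.
pose f := a · tl T H.
have fp : f · tp T (T H) = a · tp T H · tz T H by rewrite /f -compA tlp compA.
have fTp : f · T # tp T H = a · tp T H · tz T H by rewrite /f -compA tlTp compA.
have F : f · T # tp T H = f · tp T (T H) · tp T H · tz T H.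
  by rewrite fp -(compA _ (tz T H)) tzp compm1.
have zE : f · tp T (T H) · tz T (T H) = f · T # tp T H · T # tz T H.
  by rewrite fp fTp -(compA _ (tz T H)) tz_nat compA.
have lE (u : Hom X (T H)) : u · tl T H = f -> u · tp T H = a · tp T H ->
    u = lift F.
  move=> uf up.
  have K : f · tp T (T H) · tz T (T H) · T # tp T H = u · tl T H · T # tp T H.
    by apply: xi_Tp; rewrite fp up -(compA _ (tz T H)) tzp compm1.
  by apply: (@lift_uniq _ _ _ _ _ F _ K); rewrite (addTTC K (esym K))
    addTT0 // uf.
by rewrite (lE a) // -(lE b).
Qed.

End Directions.

(** * PLIVFs and their brackets through values at the unit *)

Section Values.
Context (C : category) (T : cartesian_tangent C) (G : group_object T).

Local Notation pi1 := (@pi1 C T _ _).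
Local Notation pi2 := (@pi2 C T _ _).

Definition unit_point (A : C) : Hom A (pro T G A) := ⟨eunit G A, idm A⟩.

Definition plivf_val (A : C) (X : plivf G A) : Hom A (T G) := unit_point A · X.

Lemma plivf_val_p (A : C) (X : plivf G A) :
  plivf_val X · tp T G = eunit G A.
Proof. by rewrite -compA plv_p mpair1. Qed.

(** Left invariance evaluated at the pair of [g] and the unit. *)
Lemma plivf_valE (A : C) (X : plivf G A) :
  X = emul (H := tgroup G) (pi1 · tz T G) (pi2 · plivf_val X) :> Hom _ _.
Proof.
pose h : Hom (pro T G A) (pro T G (pro T G A)) := ⟨pi1, pi2 · unit_point A⟩.
have E := congr1 (fun x => h · x) (plv_inv X).
rewrite /= comp_tmul !compA mpair1 mpair2 -(compA pi2) in E.
rewrite temulE -E -[LHS]comp1m; congr (_ · _).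
apply: pro_ext; rewrite comp1m -compA.
  rewrite gmul_id1 compA comp_mpair mpair1 compA mpair2 -compA mpair1.
  by rewrite comp_eunit; apply/esym/emule.
by rewrite gmul_id2 compA mpair2 -compA mpair2 compm1.
Qed.

Lemma plivf_val_inj (A : C) : injective (@plivf_val A).
Proof.
by move=> X Y E; apply: plivf_eq; rewrite (plivf_valE X) (plivf_valE Y) E.
Qed.

Lemma plivf_val_map (A B : C) (f : Hom A B) (X : plivf G B) :
  plivf_val (plivf_map f X) = f · plivf_val X.
Proof.
rewrite /plivf_val /= !compA; congr (_ · _).
apply: pro_ext; rewrite -!compA ?mpair1 ?mpair2.
  by rewrite comp_eunit.
by rewrite compA mpair2 comp1m compm1.
Qed.

Lemma plivf_val0 (A : C) : plivf_val (plivf0 G A) = eunit (tgroup G) A.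
Proof. by rewrite /plivf_val /= compA mpair1 teunitE. Qed.

Lemma plivf_valD (A : C) (X Y : plivf G A) :
  plivf_val (plivfD X Y) = emul (H := tgroup G) (plivf_val X) (plivf_val Y).
Proof.
have E : plivf_val X · tp T G = plivf_val Y · tp T G by rewrite !plivf_val_p.
rewrite /plivf_val /= (comp_addT _ E) addT_emul plivf_val_p -teunitE.
by rewrite einv1 emul1.
Qed.

Lemma plivf_val_bracket_term (A : C) (X Y : plivf G A) :
  unit_point A · bracket_term X Y
  = emul (H := tgroup (tgroup G))
      (plivf_val X · T # tz T G) (plivf_val Y · tz T (T G)).
Proof.
rewrite /bracket_term compA comp_tpair compA mpair2 comp1m -/(plivf_val X).
rewrite {1}(plivf_valE Y) comp_Temul !fmapM !compA tpair1 tpair2.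
by rewrite -tz_nat -(compA _ _ (T # Y)) -tz_nat compA.
Qed.

(** Conjugation by the flip turns [T] of the formula for [gneg] into the same formula, zero times
    inverse times zero, in the group [T (T G)]. *)
Lemma comp_negTT (X : C) (v : Hom X (T (T G))) :
  v · negTT (gneg G)
  = emul (H := tgroup (tgroup G))
      (emul (v · tp T (T G) · tz T (T G)) (einv v))
      (v · tp T (T G) · tz T (T G)).
Proof.
set h := _ · tz T (T G); have gE : gneg G
    = emul (H := tgroup G)
        (emul (tp T G · tz T G) (einv (idm (T G)))) (tp T G · tz T G).
  by rewrite !temulE /einv comp1m.
rewrite /negTT gE !compA !comp_Temul !tc_ghom.
have -> : v · tc T G · T # (tp T G · tz T G) · tc T G = h.
  rewrite fmapM !compA -(compA v) tcTp -(compA (v · _)).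
  by rewrite -tzc -!compA tcK compm1 /h compA.
congr (emul (emul h _) h).
rewrite /einv comp1m /= -compA tc_nat compA -(compA v) tcK compm1.
by [].
Qed.

Lemma plivf_val_bracket_diff (A : C) (X Y : plivf G A) :
  let x := plivf_val X · T # tz T G in
  let y := plivf_val Y · tz T (T G) in
  unit_point A · bracket_diff X Y
  = emul (H := tgroup (tgroup G)) (ecomm x y) y.
Proof.
move=> x y; rewrite /bracket_diff /subTT.
set H := subTT_comm _ _.
have H1 : unit_point A · bracket_term X Y · tp T (T G)
    = unit_point A · (bracket_term Y X · tc T G · negTT (gneg G))
      · tp T (T G).
  by rewrite -2!(compA (unit_point A)) H.
rewrite (comp_addT _ H1) addT_emul -(compA (unit_point A)) bracket_term_p.
rewrite -/(plivf_val Y) -/y 2!(compA (unit_point A)).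
have vp : unit_point A · bracket_term Y X · tc T G · tp T (T G) = plivf_val Y.
  by rewrite -(compA _ (tc T G)) tcp -compA bracket_term_Tp.
have vE : unit_point A · bracket_term Y X · tc T G
    = emul (H := tgroup (tgroup G)) y x.
  rewrite plivf_val_bracket_term tc_ghom.
  by rewrite -(compA (plivf_val X)) -(compA (plivf_val Y)) Tzc tzc.
(* The difference of [x y] and [y x] over the base [y] is [(x y) y^-1 (y (y x)^-1 y)]. *)
rewrite comp_negTT vp -/y vE plivf_val_bracket_term -/x -/y.
by rewrite !einvM /ecomm !emulA !emulVK.
Qed.

Lemma plivf_val_bracket (A : C) (X Y : plivf G A) :
  plivf_val (plivf_bracket X Y) · tl T G
  = ecomm (H := tgroup (tgroup G))
      (plivf_val X · T # tz T G) (plivf_val Y · tz T (T G)).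
Proof.
set b := plivf_val _; set y := plivf_val Y · _.
have dp : unit_point A · (bracket_diff X Y · tp T (T G) · tz T (T G)) = y.
  by rewrite bracket_diff_p compA.
have K : bracket_diff X Y · tp T (T G) · tz T (T G) · T # tp T G
    = plivf_bracket X Y · tl T G · T # tp T G.
  by apply: xi_Tp; rewrite bracket_diff_p !plv_p.
have yT : y · T # tp T G = eunit (tgroup G) A.
  by rewrite -compA -tz_nat compA plivf_val_p teunitE.
have bT : b · tl T G · T # tp T G = eunit (tgroup G) A.
  by rewrite -compA tlTp compA plivf_val_p teunitE.
have K' : unit_point A · (bracket_diff X Y · tp T (T G) · tz T (T G))
      · T # tp T G
    = unit_point A · (plivf_bracket X Y · tl T G) · T # tp T G.
  by rewrite -2!(compA (unit_point A)) K.
have := plivf_val_bracket_diff X Y.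
rewrite /= -/y -(lift_spec (H := bracket_diff_lift X Y) K) (comp_addTT K K').
have K'' : y · T # tp T G = b · tl T G · T # tp T G by rewrite yT.
(* At the unit the sum defining the lift lies in the kernel of [T # p], so it is the commuting
   product of [y] and [b · tl T G]; then [y] cancels. *)
rewrite (addTT_congr K' K'' dp (compA _ _ _)) addTT_emul // kerTp_comm //.
exact: emulI.
Qed.

End Values.


(** * A Jacobi identity for group commutators *)

Section Jacobi.
Context (C : category) (T : cartesian_tangent C) (H : group_object T) (X : C).

Definition abelian_ker (H' : group_object T) (f : Hom H H') : Prop :=
  forall u v : Hom X H,
  u · f = eunit H' X -> v · f = eunit H' X -> emul u v = emul v u.

(** The kernel of [f] is normal, so with [b] it contains [ecomm a b] and the commutator of that with
    [c]; being abelian, it lets [ecomm_conj] apply. *)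
Lemma ecomm_ker_conj (H' : group_object T) (f : Hom H H')
    (a b c : Hom X H) :
  is_ghom f -> abelian_ker f -> b · f = eunit H' X ->
  ecomm (ecomm a b) (emul (emul b c) (einv b)) = ecomm (ecomm a b) c.
Proof.
move=> Hf Kf b0.
have u0 : ecomm a b · f = eunit H' X.
  by rewrite (ghom_comm Hf) b0 -ecomm_inv ecomm1 einv1.
apply: ecomm_conj; first exact: Kf.
by apply: Kf => //; rewrite (ghom_comm Hf) u0 ecomm1.
Qed.

(* Each of [a], [b], [c] lies in a normal abelian subgroup, so the conjugations
   in the Hall-Witt identity disappear. *)
Lemma ecomm_jacobi (Ha Hb Hc : group_object T)
    (fa : Hom H Ha) (fb : Hom H Hb) (fc : Hom H Hc) (a b c : Hom X H) :
  is_ghom fa -> is_ghom fb -> is_ghom fc ->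
  abelian_ker fa -> abelian_ker fb -> abelian_ker fc ->
  a · fa = eunit Ha X -> b · fb = eunit Hb X -> c · fc = eunit Hc X ->
  emul (emul (ecomm (ecomm a b) c) (ecomm (ecomm b c) a))
    (ecomm (ecomm c a) b) = eunit H X.
Proof.
move=> Ga Gb Gc Ka Kb Kc a0 b0 c0; rewrite -(Hall_Witt a b c).
by rewrite (ecomm_ker_conj _ _ Gb Kb b0) (ecomm_ker_conj _ _ Gc Kc c0)
  (ecomm_ker_conj _ _ Ga Ka a0).
Qed.

End Jacobi.

(** * The bracket on the kernel of [p] *)

Section KernelBracket.
Context (C : category) (T : cartesian_tangent C) (G : group_object T).

Local Notation TG := (tgroup G).
Local Notation TTG := (tgroup TG).
Local Notation TTTG := (tgroup TTG).

(* For [x], [y], [u] in the kernel of [p], the group commutator of [x] and [y],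
   put in the two directions of [T (T G)], is killed by both projections, and
   [u] is its preimage under the vertical lift. *)
Definition is_kbracket (X : C) (x y u : Hom X (T G)) : Prop :=
  u · tl T G = ecomm (H := TTG) (x · T # tz T G) (y · tz T (T G)).

(** The flip fixes the image of [tl] and exchanges the two directions. *)
Lemma kbracket_swap (X : C) (x y u : Hom X (T G)) : is_kbracket x y u ->
  u · tl T G = ecomm (H := TTG) (x · tz T (T G)) (y · T # tz T G).
Proof.
move=> uE; rewrite -tl_tc compA uE (ghom_comm (@tc_ghom _ _ G)).
by rewrite -(compA x) -(compA y) Tzc tzc.
Qed.

Lemma kbracketC (X : C) (x y u v : Hom X (T G)) :
  is_kbracket x y u -> is_kbracket y x v -> emul (H := TG) u v = eunit TG X.
Proof.
move=> /kbracket_swap uE vE; apply: tl_inj.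
by rewrite tl_ghom uE vE -(ecomm_inv (x · _)) emulVr (ghom1 (@tl_ghom _ _ G)).
Qed.

Lemma kbracket0 (X : C) (y u : Hom X (T G)) :
  is_kbracket (eunit TG X) y u -> u = eunit TG X.
Proof.
rewrite /is_kbracket (ghom1 (T_ghom (@tz_ghom _ _ G))) ecomm1 => uE.
by apply: tl_inj; rewrite uE (ghom1 (@tl_ghom _ _ G)).
Qed.

Lemma kbracketD (X : C) (x x' y u u' v : Hom X (T G)) :
  x · tp T G = eunit G X -> x' · tp T G = eunit G X ->
  u · tp T G = eunit G X -> u' · tp T G = eunit G X ->
  is_kbracket x y u -> is_kbracket x' y u' ->
  is_kbracket (emul (H := TG) x x') y v -> v = emul (H := TG) u u'.
Proof.
move=> x0 x'0 u0 u'0 uE u'E vE; apply: tl_inj.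
rewrite (kerp_comm u0 u'0) vE (T_ghom (@tz_ghom _ _ G)) ecomm_mull.
rewrite tl_ghom uE; congr (emul _ _).
(* The conjugation by [x] in [ecomm_mull] is trivial: [x · T # tz T G] and [u' · tl T G] both lie in
   the kernel of [tp T (T G)]. *)
rewrite -u'E emulA (@kerp_comm _ _ TG _ (x · _)) ?emulK //.
  by rewrite -compA tp_nat compA x0 teunitE.
by rewrite -compA tlp compA u'0 teunitE.
Qed.

Lemma kerTTp_comm (X : C) (a b : Hom X (T (T (T G)))) :
  a · T # T # tp T G = eunit TTG X -> b · T # T # tp T G = eunit TTG X ->
  emul (H := TTTG) a b = emul (H := TTTG) b a.
Proof.
have cE (u : Hom X (T (T (T G)))) :
    u · T # tc T G · T # tp T (T G) = u · T # T # tp T G.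
  by rewrite -compA -fmapM tcp.
have cK (u : Hom X (T (T (T G)))) : u · T # tc T G · T # tc T G = u.
  by rewrite -compA -fmapM tcK fmap1 compm1.
move=> a0 b0; have Gc := T_ghom (@tc_ghom _ _ G).
rewrite -[LHS]cK -[RHS]cK (Gc _ a b) (Gc _ b a).
by congr (_ · _); apply: (@kerTp_comm _ _ TG); rewrite cE.
Qed.

(* In the three tangent directions of [T (T (T G))], [x], [y] and [w] are put
   in the outermost, the middle and the innermost one. *)
Lemma kbracket_jacobi (X : C) (x y w u v r a b c : Hom X (T G)) :
  x · tp T G = eunit G X -> y · tp T G = eunit G X ->
  w · tp T G = eunit G X ->
  is_kbracket x y u -> is_kbracket y w v -> is_kbracket w x r ->
  is_kbracket u w a -> is_kbracket v x b -> is_kbracket r y c ->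
  emul (H := TG) (emul (H := TG) a b) c = eunit TG X.
Proof.
move=> x0 y0 w0 uE vE /kbracket_swap rE aE bE cE.
pose o := x · T # tz T G · T # T # tz T G.
pose m := y · tz T (T G) · T # T # tz T G.
pose i := w · tz T (T G) · tz T (T (T G)).
(* The same placements spelled differently by naturality of [tz], as the different inner brackets
   produce them. *)
have oE : o = x · T # tz T G · T # tz T (T G).
  by rewrite /o -!(compA x) -!fmapM tz_nat.
have mE : m = y · T # tz T G · tz T (T (T G)).
  by rewrite /m -!(compA y) tz_nat.
have iE : i = w · tz T (T G) · T # tz T (T G).
  by rewrite /i -!(compA w) tz_nat.
have om : u · tl T G · T # T # tz T G = ecomm (H := TTTG) o m.
  by rewrite uE (ghom_comm (T_ghom (T_ghom (@tz_ghom _ _ G)))).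
have mi : v · tl T G · tz T (T (T G)) = ecomm (H := TTTG) m i.
  by rewrite vE (ghom_comm (@tz_ghom _ _ TTG)) mE.
have io : r · tl T G · T # tz T (T G) = ecomm (H := TTTG) i o.
  by rewrite rE (ghom_comm (T_ghom (@tz_ghom _ _ TG))) oE iE.
have omi : a · tl T G · tl T (T G)
    = ecomm (H := TTTG) (ecomm (H := TTTG) o m) i.
  rewrite aE (ghom_comm (@tl_ghom _ _ TG)) -om -(compA u) -tl_nat compA.
  by rewrite -(compA w) tzl compA iE.
have mio : b · tl T G · tl T (T G)
    = ecomm (H := TTTG) (ecomm (H := TTTG) m i) o.
  rewrite -mi -(compA b) -tl_coassoc compA (kbracket_swap bE).
  rewrite (ghom_comm (T_ghom (@tl_ghom _ _ G))) -(compA v).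
  rewrite (tz_nat T (tl T G)) compA.
  by rewrite /o -!(compA x) -!fmapM tzl.
have iom : c · tl T G · tl T (T G)
    = ecomm (H := TTTG) (ecomm (H := TTTG) i o) m.
  (* Coassociativity and [l c = l] let [T # tc] be appended after the double lift; it moves [y] to
     the middle direction. *)
  rewrite -(compA c) -tl_coassoc -[in T # tl T G](tl_tc T G) fmapM.
  rewrite (compA (tl T G)) tl_coassoc !compA cE.
  rewrite (ghom_comm (@tl_ghom _ _ TG)) (ghom_comm (T_ghom (@tc_ghom _ _ G))).
  rewrite -io -(compA r _ (tl T _)) (tl_nat T (tz T G)) -(compA y) tzl !compA.
  by rewrite -!(compA _ _ (T # tc T G)) -!fmapM Tzc tzc.
apply: tl_inj; apply: (@tl_inj _ _ TG).
rewrite !(@tl_ghom _ _ G) !(@tl_ghom _ _ TG) omi mio iom.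
rewrite (ghom1 (@tl_ghom _ _ G)) (ghom1 (@tl_ghom _ _ TG)).
(* The three projections kill [o], [m] and [i] respectively. *)
apply: (@ecomm_jacobi _ _ TTTG X TTG TTG TTG (tp T (T (T G))) (T # tp T (T G))
  (T # T # tp T G)).
- exact: (@tp_ghom _ _ TTG).
- exact: (T_ghom (@tp_ghom _ _ TG)).
- exact: (T_ghom (T_ghom (@tp_ghom _ _ G))).
- by move=> ? ?; apply: (@kerp_comm _ _ TTG).
- by move=> ? ?; apply: (@kerTp_comm _ _ TG).
- by move=> ? ?; apply: kerTTp_comm.
- have -> : o · tp T (T (T G)) = eunit TG X · T # tz T G.
    by rewrite /o -compA tp_nat compA -(compA x) tp_nat (compA x) x0 -teunitE.
  exact: (ghom1 (T_ghom (@tz_ghom _ _ G))).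
- have -> : m · T # tp T (T G) = eunit TG X · T # tz T G.
    rewrite /m -compA -fmapM tp_nat fmapM compA -(compA y) -tz_nat (compA y).
    by rewrite y0 -teunitE.
  exact: (ghom1 (T_ghom (@tz_ghom _ _ G))).
- have -> : i · T # T # tp T G = eunit TG X · tz T (T G).
    by rewrite /i -compA -tz_nat compA -(compA w) -tz_nat (compA w) w0 -teunitE.
  exact: (ghom1 (@tz_ghom _ _ TG)).
Qed.

End KernelBracket.

(** * Transfer of the laws to the representing object *)

Section Representation.
Context (C : category) (T : cartesian_tangent C) (G : group_object T)
  (R : lie_representation G).

(** For [Te_representation] this is the inclusion [TeG_incl]. *)
Definition lie_val : Hom (lie_obj R) (T G) := plivf_val (lie_omega R).

Lemma lie_phi_val (A : C) (X : plivf G A) :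
  lie_phi R X · lie_val = plivf_val X.
Proof. by rewrite -plivf_val_map lie_phi_omega. Qed.

(** Reduces each Lie algebra law to an identity in the group [T G]. *)
Lemma lie_val_inj (A : C) (f f' : Hom A (lie_obj R)) :
  f · lie_val = f' · lie_val -> f = f'.
Proof.
rewrite -!plivf_val_map => /plivf_val_inj E.
by rewrite (lie_phi_uniq E) -(lie_phi_uniq erefl).
Qed.

Lemma lie_val_p (A : C) (f : Hom A (lie_obj R)) :
  f · lie_val · tp T G = eunit G A.
Proof. by rewrite -compA plivf_val_p comp_eunit. Qed.

Lemma lie_zero_val (A : C) :
  to_one T A · lie_zero R · lie_val = eunit (tgroup G) A.
Proof. by rewrite -compA lie_phi_val plivf_val0 comp_eunit. Qed.

Lemma lie_add_val (A : C) (x y : Hom A (lie_obj R)) :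
  ⟨x, y⟩ · lie_add R · lie_val
  = emul (H := tgroup G) (x · lie_val) (y · lie_val).
Proof.
rewrite -compA lie_phi_val plivf_valD !plivf_val_map comp_emul !compA.
by rewrite mpair1 mpair2.
Qed.

Lemma lie_bracket_val (A : C) (x y : Hom A (lie_obj R)) :
  is_kbracket (x · lie_val) (y · lie_val) (⟨x, y⟩ · lie_bracket R · lie_val).
Proof.
rewrite /is_kbracket -(compA _ (lie_bracket R)) lie_phi_val -compA.
rewrite plivf_val_bracket !plivf_val_map.
by rewrite (comp_ecomm (H := tgroup (tgroup G))) !compA mpair1 mpair2.
Qed.

End Representation.

Theorem theorem5p4 (C : category) (T : cartesian_tangent C) (G : lie_group T)
    (R : lie_representation G) :
  is_lie_algebra_object (lie_zero R) (lie_add R) (lie_bracket R).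
Proof.
split=> [X x|X x y|X x y w|X y|X x x' y|X x y|X x y w]; apply: lie_val_inj;
  rewrite ?lie_add_val ?lie_zero_val.
- exact: emule.
- by apply: kerp_comm; apply: lie_val_p.
- exact: emulA.
- by apply: (kbracket0 (y := y · lie_val R));
  rewrite -(lie_zero_val R); apply: lie_bracket_val.
- apply: kbracketD; try exact: lie_bracket_val; try exact: lie_val_p.
  by rewrite -lie_add_val; apply: lie_bracket_val.
- by apply: kbracketC; apply: lie_bracket_val.
- have p := @lie_val_p _ _ _ R X; have B := @lie_bracket_val _ _ _ R X.
  exact: (kbracket_jacobi (p x) (p y) (p w) (B x y) (B y w) (B w x)
    (B _ w) (B _ x) (B _ y)).
Qed.
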